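(* Let $(G_\sigma)_{\sigma\ge1}$ be a log-convolution semi-group with Laplace exponent $$\psi(\lambda)=\beta\lambda+\int_0^\infty\left(1-e^{-\lambda x}\right)\nu(dx).$$ If $\psi(1/2)=1$, then there exists a Markov martingale $(X_t)_{t\ge0}$ starting at zero, with transition probabilities $P_{s,t}(x,dy)$ (defined in the context), whose marginal distributions are Gaussian: for each $t$, $X_t$ is Gaussian with mean zero and variance $t$.
   Context: $\varepsilon_a$ is the Dirac measure at $a$; $\phi(\mu,v,\cdot)$ is the density of the Gaussian distribution with mean $\mu$ and variance $v$. A family $(G_\sigma)_{\sigma\ge1}$ of probability measures on $[0,1]$ is a log-convolution semi-group if, for all $\sigma,\tau\ge1$, the product of two independent random variables with distributions $G_\sigma$ and $G_\tau$ has distribution $G_{\sigma\tau}$. Saying that it has Laplace exponent $\psi$ means that, for $R_\sigma$ distributed as $G_\sigma$, $L_\sigma(\lambda):=\mathbb{E}[(R_\sigma)^\lambda]=\sigma^{-\psi(\lambda)}$ for all $\sigma\ge1$, $\lambda>0$, where $\beta\ge0$ and $\nu$ is a measure on $[0,\infty)$ with $\nu(\{0\})=0$ and $\int_0^\infty(1\wedge x)\nu(dx)<\infty$. In particular $R_\sigma>0$ almost surely and $U_\sigma=-\ln R_\sigma$ is a nonnegative infinitely divisible random variable. Transition probabilities: for $t>0$, $P_{0,t}(x,dy)=\phi(x,t,y)\,dy$; for $0<s<t$, with $\sigma=\sqrt{t/s}$ and $\gamma(\sigma)=G_\sigma(\{1\})$, $$P_{s,t}(x,dy)=\gamma(\sigma)\,\varepsilon_{\sigma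 x}(dy)+\left(\int_{[0,1)}\phi\big(\sigma\sqrt r\,x,\;t(1-r),\;y\big)\,G_\sigma(dr)\right)dy.$$ *)

(* Defs.v *)
From HB Require Import structures.
From mathcomp Require Import all_boot all_order all_algebra.
From mathcomp Require Import all_classical all_reals all_analysis.
From mathcomp Require Import measurable_realfun.
Set Implicit Arguments.
Unset Strict Implicit.
Unset Printing Implicit Defensive.
Import Order.TTheory GRing.Theory Num.Theory.
Import numFieldNormedType.Exports.
Local Open Scope classical_set_scope.
Local Open Scope ring_scope.
Local Open Scope ereal_scope.

Definition independent_rv (R : realType) (d : measure_display)
    (Omega : measurableType d) (P : probability Omega R)
    (X Y : {RV P >-> R}) : Prop :=
  forall A B : set R, measurable A -> measurable B ->
    P (X @^-1` A `&` Y @^-1` B) = P (X @^-1` A) * P (Y @^-1` B).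

Definition has_law (R : realType) (d : measure_display)
    (Omega : measurableType d) (P : probability Omega R)
    (X : {RV P >-> R}) (m : set R -> \bar R) : Prop :=
  forall A : set R, measurable A -> distribution P X A = m A.

(* A family indexed by [1, +oo[ is a function on R; its values at arguments
   smaller than 1 are never used. *)
Definition log_convolution_semigroup (R : realType)
    (G : R -> probability (measurableTypeR R) R) : Prop :=
  (forall s : R, (1 <= s)%R -> G s `[0%R, 1%R]%classic = 1) /\
  (forall s t : R, (1 <= s)%R -> (1 <= t)%R ->
    forall (d : measure_display) (Omega : measurableType d)
      (P : probability Omega R) (X Y : {RV P >-> R}),
    independent_rv X Y -> has_law X (G s) -> has_law Y (G t) ->
    forall A : set R, measurable A ->
      P ((fun w => X w * Y w)%R @^-1` A) = G (s * t)%R A).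

(* A measure on [0, +oo[ is a measure on R vanishing on the complement. *)
Definition levy_measure (R : realType)
    (nu : {measure set (measurableTypeR R) -> \bar R}) : Prop :=
  [/\ nu `]-oo, 0%R[%classic = 0,
      nu [set 0%R] = 0 &
      \int[nu]_(x in `[0%R, +oo[) (Num.min 1 x)%:E < +oo].

Definition levy_exponent (R : realType) (beta : R)
    (nu : {measure set (measurableTypeR R) -> \bar R}) (lambda : R) : R :=
  (beta * lambda +
     Rintegral nu `[0, +oo[ (fun x => 1 - expR (- (lambda * x))))%R.

Definition has_laplace_exponent (R : realType)
    (G : R -> probability (measurableTypeR R) R) (psi : R -> R) : Prop :=
  forall s lambda : R, (1 <= s)%R -> (0 < lambda)%R ->
    'E_(G s)[fun r : R => r `^ lambda]%R = (s `^ (- psi lambda))%:E.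

(* [normal_pdf] and [normal_prob] take the standard deviation, whereas v is
   the variance; they only have their usual meaning when v > 0. *)
Definition gauss_density (R : realType) (m v y : R) : R :=
  normal_pdf m (Num.sqrt v) y.

Definition gauss_law (R : realType) (m v : R) (A : set R) : \bar R :=
  if v == 0%R then \d_m A else normal_prob m (Num.sqrt v) A.

Definition transition (R : realType)
    (G : R -> probability (measurableTypeR R) R)
    (s t x : R) (A : set R) : \bar R :=
  if s == 0%R then
    \int[lebesgue_measure]_(y in A) (gauss_density x t y)%:E
  else
    let sigma := Num.sqrt (t / s)%R in
    G sigma [set 1%R] * \d_(sigma * x)%R A +
    \int[lebesgue_measure]_(y in A)
      \int[G sigma]_(r in `[0%R, 1%R[)
        (gauss_density (sigma * Num.sqrt r * x) (t * (1 - r)) y)%:E.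

(* Processes are indexed by [0, +oo[: values at negative times are never
   used. *)
Definition natural_filtration (R : realType) (d : measure_display)
    (Omega : measurableType d) (X : R -> Omega -> R) (s : R)
    : set (set Omega) :=
  <<s [set C | exists (u : R) (B : set R),
         [/\ (0 <= u <= s)%R, measurable B & C = X u @^-1` B]] >>.

(* Y is a version of the conditional expectation of Z given the
   sub-sigma-algebra F. *)
Definition is_cond_expectation (R : realType) (d : measure_display)
    (Omega : measurableType d) (P : probability Omega R)
    (F : set (set Omega)) (Z Y : Omega -> \bar R) : Prop :=
  [/\ forall B : set (\bar R), measurable B -> F (Y @^-1` B),
      P.-integrable setT Y &
      forall C : set Omega, F C ->
        \int[P]_(w in C) Y w = \int[P]_(w in C) Z w].

Definition martingale (R : realType) (d : measure_display)
    (Omega : measurableType d) (P : probability Omega R)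
    (X : R -> {RV P >-> R}) : Prop :=
  (forall t : R, (0 <= t)%R -> P.-integrable setT (EFin \o X t)) /\
  (forall s t : R, (0 <= s)%R -> (s <= t)%R ->
    is_cond_expectation P (natural_filtration X s)
      (EFin \o X t) (EFin \o X s)).

Definition markov_process (R : realType) (d : measure_display)
    (Omega : measurableType d) (P : probability Omega R)
    (X : R -> {RV P >-> R}) (p : R -> R -> R -> set R -> \bar R) : Prop :=
  (forall s t : R, (0 <= s)%R -> (s < t)%R ->
    exists k : R.-pker (measurableTypeR R) ~> (measurableTypeR R),
      forall (x : R) (A : set R), measurable A -> k x A = p s t x A) /\
  (forall (s t : R) (A : set R), (0 <= s)%R -> (s < t)%R -> measurable A ->
    is_cond_expectation P (natural_filtration X s)
      (fun w => (\1_(X t @^-1` A) w)%:E) (fun w => p s t (X s w) A)).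

(* Main.v *)
(* Writing R_sigma for a variable of law G_sigma and Z for a standard Gaussian,
   P_{s,t}(x, .) is the law of sigma sqrt(R_sigma) x + sqrt(t (1 - R_sigma)) Z.
   Since a N(m, v) + N(0, w) = N(a m, a^2 v + w) and R_sigma R_tau has the law
   of R_{sigma tau}, these kernels satisfy the Chapman-Kolmogorov equation, and
   they map N(0, s) to N(0, t). The martingale property only asks that
   sigma E[sqrt(R_sigma)] = 1, which is psi(1/2) = 1.

   The process itself comes from Kolmogorov's extension theorem in a form that
   needs no topology on R: a path is encoded by the bits (X_t <= q) for q
   rational, and on a space of bit families the finite intersection property of
   cylinders makes every finitely additive measure on them sigma-additive. *)
Require Import Defs.
From HB Require Import structures.
From mathcomp Require Import all_boot all_order all_algebra.
From mathcomp Require Import all_classical all_reals all_analysis.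
From mathcomp Require Import measurable_realfun ring lra.
Set Implicit Arguments.
Unset Strict Implicit.
Unset Printing Implicit Defensive.
Import Order.TTheory GRing.Theory Num.Theory.
Import numFieldNormedType.Exports.
Local Open Scope classical_set_scope.
Local Open Scope ring_scope.

(** * Measures on cylinders of Boolean sequences *)

(** At s = 0 and x different from 0 the kernels P_{s,t} violate the Chapman-Kolmogorov equation in
    general: N(x, t) is sent to a mixture of the laws N(b sqrt(r) x, u), with b = sqrt(u/t), instead
    of N(x, u). The construction therefore runs on kernels that agree with P_{0,t} only at x = 0,
    the sole value of X_0, and returns to P_{s,t} at the very end. The price of the bit encoding is
    that an event such as X_t in A is not a cylinder, since it looks at all the bits of time t.
    Identities are first proved on cylinders and then carried to whole histories by uniqueness of
    measures on a pi-system. The measures G_sigma are concentrated on [0, 1], and only there do the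
    square roots and variances have their meaning, so integrands against G_sigma are compared on
    that interval only. *)

Definition depends_on (I : choiceType) (F : seq I) (C : set (I -> bool)) :=
  forall b b', {in F, b =1 b'} -> C b -> C b'.

Definition cylinder (I : choiceType) : set (set (I -> bool)) :=
  [set C | exists F : seq I, depends_on F C].

Section cylinder_algebra.
Variable I : choiceType.
Implicit Types C D : set (I -> bool).

Lemma depends_onS (F F' : seq I) C :
  {subset F <= F'} -> depends_on F C -> depends_on F' C.
Proof. by move=> FF' dC b b' bb'; apply: dC => i /FF'; exact: bb'. Qed.

Lemma depends_onC (F : seq I) C : depends_on F C -> depends_on F (~` C).
Proof.
by move=> dC b b' bb' nCb Cb'; apply/nCb/(dC b') => // i iF; rewrite bb'.
Qed.

Lemma depends_onU (F : seq I) C D :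
  depends_on F C -> depends_on F D -> depends_on F (C `|` D).
Proof. by move=> dC dD b b' bb' [/dC|/dD] h; [left|right]; exact: h. Qed.

Lemma depends_onI (F : seq I) C D :
  depends_on F C -> depends_on F D -> depends_on F (C `&` D).
Proof. by move=> dC dD b b' bb' [Cb Db]; split; [exact: dC bb' _|exact: dD bb' _]. Qed.

Lemma cylinder_common C D : cylinder C -> cylinder D ->
  exists F, depends_on F C /\ depends_on F D.
Proof.
move=> [F dC] [F' dD]; exists (F ++ F'); split.
- by apply: depends_onS dC => i iF; rewrite mem_cat iF.
- by apply: depends_onS dD => i iF; rewrite mem_cat iF orbT.
Qed.

Lemma cylinder0 : cylinder (set0 : set (I -> bool)).
Proof. by exists [::]. Qed.

Lemma cylinderU : setU_closed (@cylinder I).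
Proof.
move=> C D cC cD; have [F [dC dD]] := cylinder_common cC cD.
by exists F; exact: depends_onU.
Qed.

Lemma cylinderC : setC_closed (@cylinder I).
Proof. by move=> C [F dC]; exists F; exact: depends_onC. Qed.

Definition cylinder_display : measure_display. Proof. exact. Qed.

(** [cyl] and [bpath] name the same type with two measurable structures: the algebra of cylinders,
    where the content lives, and the sigma-algebra generated by it. *)
Definition cyl := I -> bool.

HB.instance Definition _ := Pointed.on cyl.
HB.instance Definition _ := isAlgebraOfSets.Build cylinder_display cyl
  cylinder0 cylinderU cylinderC.

(** Compactness of the Boolean cube: an ultrafilter finer than the filter generated by the [A n]
    converges coordinatewise to a point, and each [A n], which sees finitely many coordinates,
    contains that point. The index set may be uncountable. *)
Lemma cylinder_compact (A : (set cyl)^nat) :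
  (forall n, measurable (A n)) -> nonincreasing_seq A ->
  (forall n, A n !=set0) -> \bigcap_n A n !=set0.
Proof.
move=> cA niA A0.
pose B : set_system cyl := [set D | exists n, A n `<=` D].
have FB : ProperFilter B.
  apply: Build_ProperFilter_ex.
    by move=> D [n AD]; have [b /AD] := A0 n; exists b.
  split.
  - by exists 0%N.
  - move=> P Q [n nP] [m mQ]; exists (maxn n m) => b Ab; split.
      by apply: nP; move: Ab; apply/subsetPset/niA; exact: leq_maxl.
    by apply: mQ; move: Ab; apply/subsetPset/niA; exact: leq_maxr.
  - by move=> P Q PQ [n nP]; exists n; exact: subset_trans PQ.
have [U [UU BU]] := ultraFilterLemma FB.
(* The limit point: the ultrafilter decides each bit. *)
pose b : cyl := fun i => `[< U [set w : cyl | w i] >].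
have Ub (F : seq I) : U [set w : cyl | {in F, w =1 b}].
  elim: F => [|i F IH].
    by by apply: filterS filterT.
  suff Ui : U [set w : cyl | w i = b i].
    apply: filterS (filterI Ui IH) => w [wi wF] j.
    by rewrite inE => /orP[/eqP->//|]; exact: wF.
  have [Ut|Uf] := in_ultra_setVsetC [set w : cyl | w i] UU.
    have bi : b i = true by apply/asboolP.
    by apply: filterS Ut => w /= wi; rewrite bi.
  have bi : b i = false.
    apply/asboolPn => Ut; by have [v [vi]] := filter_ex (filterI Ut Uf).
  by apply: filterS Uf => w /= /negP/negbTE ->.
exists b => n _; have [F dA] := cA n.
have UA : U (A n) by apply: BU; exists n.
have [w [/= wb Aw]] := filter_ex (filterI (Ub F) UA).
exact: dA wb Aw.
Qed.

Definition bpath := I -> bool.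

Definition bpath_display : measure_display. Proof. exact. Qed.

HB.instance Definition _ := Pointed.on bpath.
HB.instance Definition _ := @isMeasurable.Build bpath_display bpath
  <<s @cylinder I >> (@sigma_algebra0 _ setT (@cylinder I))
  (@sigma_algebraC _ (@cylinder I)) (@sigma_algebra_bigcup _ setT (@cylinder I)).

End cylinder_algebra.

Section cylinder_extension.
Local Open Scope ereal_scope.
Variables (I : choiceType) (R : realType) (mu : set (cyl I) -> \bar R).
Hypothesis mu_ge0 : forall A, 0 <= mu A.
Hypothesis muT : mu setT = 1.
Hypothesis mu_add : forall A B : set (cyl I), measurable A -> measurable B ->
  [disjoint A & B] -> mu (A `|` B) = mu A + mu B.

Let mu0 : mu set0 = 0.
Proof.
have := mu_add (@measurableT _ (cyl I)) (@measurable0 _ (cyl I)).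
rewrite setU0 muT disj_set2E setI0 eqxx => /(_ isT).
case: (mu set0) (mu_ge0 set0) => [r|//|//] _ [] /eqP.
by rewrite -subr_eq0 opprD addNKr oppr_eq0 => /eqP ->.
Qed.

Let mu_semi_additive : measure_function.semi_additive mu.
Proof.
apply/(additive2P mu0) => A B mA mB AB.
by apply: mu_add => //; apply/eqP.
Qed.

HB.instance Definition _ := isContent.Build _ (cyl I) R mu mu_ge0 mu_semi_additive.

(** By compactness a countable cover of a cylinder by cylinders has a finite subcover, so finite
    subadditivity is enough. *)
Let mu_sub : measurable_subset_sigma_subadditive mu.
Proof.
move=> A F mF mA AF.
have [N AN] : exists N, A `<=` \big[setU/set0]_(k < N) F k.
  apply: contrapT => /forallNP nA.
  pose D n := A `\` \big[setU/set0]_(k < n) F k.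
  have mU n : measurable (\big[setU/set0]_(k < n) F k).
    by apply: bigsetU_measurable => k _; exact: mF.
  have [||n|b Db] := @cylinder_compact I D.
  - by move=> n; apply: measurableD.
  - by move=> m n mn; apply/subsetPset; apply: setDS; exact: subset_bigsetU.
  - apply: contrapT => D0; apply: (nA n) => b Ab; apply: contrapT => nb.
    by apply: D0; exists b.
  - have [Ab _] := Db 0%N Logic.I.
    have [n _ Fn] := AF _ Ab.
    have [_] := Db n.+1 Logic.I; apply.
    by rewrite big_ord_recr/=; right.
apply: (@le_trans _ _ (\sum_(k < N) mu (F k))).
  by apply: content_subadditive => // k _; exact: mF.
rewrite -(big_mkord xpredT (mu \o F)).
by apply: nneseries_lim_ge => k _ _; exact: mu_ge0.
Qed.

HB.instance Definition _ :=
  Content_SigmaSubAdditive_isMeasure.Build _ R (cyl I) mu mu_sub.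

Let measure_extensionE C : cylinder C -> measure_extension mu C = mu C.
Proof. by move=> cC; exact: measurable_mu_extE. Qed.

Let measure_extensionT : measure_extension mu setT = 1.
Proof. by rewrite measure_extensionE//; exact: (@measurableT _ (cyl I)). Qed.

(** The Caratheodory extension lives on the sigma-algebra generated by the measurable sets of
    [cyl I], which are the cylinders; it is restated here as a measure on [bpath I]. *)
Definition cylinder_measure : set (bpath I) -> \bar R := measure_extension mu.

HB.instance Definition _ := isMeasure.Build _ (bpath I) R cylinder_measure
  (measure0 (measure_extension mu)) (measure_ge0 (measure_extension mu))
  (@measure_semi_sigma_additive _ _ _ (measure_extension mu)).

HB.instance Definition _ :=
  Measure_isProbability.Build _ _ _ cylinder_measure measure_extensionT.

Lemma cylinder_extension :
  exists P : probability (bpath I) R, forall C, cylinder C -> P C = mu C.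
Proof. by exists cylinder_measure. Qed.

End cylinder_extension.

(** * Path space *)

Section kprecomp.
Context d1 d2 d3 (X : measurableType d1) (Y : measurableType d2)
  (Z : measurableType d3) (R : realType).
Variables (k : R.-pker Y ~> Z) (f : X -> Y).

Definition kprecomp (mf : measurable_fun setT f) (x : X) :
  {measure set Z -> \bar R} := k (f x).

Hypothesis mf : measurable_fun setT f.

Let measurable_kprecomp U : measurable U ->
  measurable_fun setT (kprecomp mf ^~ U).
Proof.
by move=> mU; exact: (measurableT_comp (measurable_kernel k U mU) mf).
Qed.

HB.instance Definition _ := isKernel.Build _ _ X Z R (kprecomp mf)
  measurable_kprecomp.

Let kprecomp_prob x : kprecomp mf x setT = 1%E.
Proof. exact: prob_kernel. Qed.

HB.instance Definition _ := Kernel_isProbability.Build _ _ X Z R (kprecomp mf)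
  kprecomp_prob.

End kprecomp.

Section kcomp_probability.
Context d1 d2 d3 (X : measurableType d1) (Y : measurableType d2)
  (Z : measurableType d3) (R : realType).
Variables (l : R.-pker X ~> Y) (k : R.-pker (X * Y) ~> Z).

Let kcomp_prob x : mkcomp l k x setT = 1%E.
Proof.
rewrite /mkcomp/= /kcomp; under eq_integral do rewrite prob_kernel.
by rewrite integral_cst// prob_kernel mule1.
Qed.

HB.instance Definition _ := Kernel_isProbability.Build _ _ X Z R (mkcomp l k)
  kcomp_prob.

End kcomp_probability.

Section path_space.
Variable R : realType.

Local Notation path := (bpath (R * rat)%type).

Implicit Types (b : path) (t u x y : R).

Lemma measurable_coord (i : R * rat) : measurable [set b : path | b i].
Proof.
apply: sub_sigma_algebra; exists [:: i] => b b' bb' /=.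
by rewrite -bb' ?inE.
Qed.

(** A cylinder over [i :: F] splits along the value of the bit [i]; once that bit is frozen by
    [sub], the remaining condition depends on [F] only. *)
Lemma measurable_fun_path d (T : measurableType d) (f : T -> path) :
  (forall i, measurable [set w | f w i]) -> measurable_fun setT f.
Proof.
move=> mf; apply: (@measurability _ _ T path setT f (@cylinder (R * rat)%type)) => // _ [C [F dC] <-].
rewrite setTI; elim: F C dC => [|i F IH] C dC.
  have [->|/set0P[b Cb]] := eqVneq C set0; first by rewrite preimage_set0.
  rewrite (_ : _ @^-1` _ = setT)//; apply/seteqP; split => // w _ /=.
  exact: dC Cb.
pose sub v (b : path) : path := fun j => if j == i then v else b j.
pose D v : set path := sub v @^-1` C.
have dD v : depends_on F (D v).
  move=> b b' bb'; apply: dC => j; rewrite inE /sub; case: eqP => //= _.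
  exact: bb'.
have -> : f @^-1` C = ([set w | f w i] `&` f @^-1` D true) `|`
    (~` [set w | f w i] `&` f @^-1` D false).
  have subE (b : path) v : b i = v -> sub v b = b.
    by move=> bi; apply/funext => j; rewrite /sub; case: eqP => // ->.
  apply/seteqP; split => w /=; rewrite /D /=.
    move=> Cw; have [fi|/negP fi] := boolP (f w i); [left|right]; split => //.
      by rewrite subE.
    by rewrite subE//; apply/negbTE/negP.
  by move=> [[fi]|[/negP/negbTE fi]]; rewrite subE.
apply: measurableU; (apply: measurableI; last exact: IH); last exact: measurableC.
exact: mf.
Qed.

(* The coordinate [(t, q)] of a path records whether its value at time [t] is
   at most [q]. *)
Definition upd t y b : path := fun i => if i.1 == t then y <= ratr i.2 else b i.

(** Decoding: a real is the infimum of the rationals above it. For bit families with an infinite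
    infimum [fine] returns 0. At times [t <= 0] the bits are ignored in favour of the start
    value. *)
Definition value_at x0 t b : R :=
  if t <= 0 then x0 else fine (ereal_inf [set (ratr q)%:E | q in [set q | b (t, q)]]).

(** The infimum is below [r] iff some true bit has its rational below [r], a countable union. The
    source [T] is arbitrary because the lemma also serves for sub-sigma-algebras of the path
    space. *)
Lemma measurable_value_at x0 t d (T : measurableType d) (f : T -> path) :
  (0 < t -> forall q, measurable [set w | f w (t, q)]) ->
  measurable_fun setT (fun w => value_at x0 t (f w)).
Proof.
rewrite /value_at => mf; case: (leP t 0) mf => t0 mf.
  exact: measurable_cst.
pose g w : \bar R := ereal_inf [set (ratr q)%:E | q in [set q | f w (t, q)]].
suff mg : measurable_fun setT g by exact: (measurableT_comp (@fine_measurable R _ measurableT) mg).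
apply: (measurability _ (ErealGenInftyO.measurableE R)) => _ /= -[_ [r ->] <-].
rewrite setTI (_ : _ @^-1` _ =
    \bigcup_q (if ratr q < r then [set w | f w (t, q)] else set0)); last first.
  apply/seteqP; split => w /=; rewrite in_itv/=.
    move=> /ereal_inf_lt[_ [q bq <-]]; rewrite lte_fin => qr.
    by exists q => //; rewrite qr.
  move=> [q _]; case: ifPn => // qr bq; apply: le_lt_trans (_ : (ratr q)%:E < r%:E)%E.
    by apply: ereal_inf_lbound; exists q.
  by rewrite lte_fin.
by apply: bigcupT_measurable_rat => q; case: ifP => // _; exact: mf.
Qed.

Lemma measurable_value_atT x0 t : measurable_fun setT (value_at x0 t).
Proof.
by apply: (@measurable_value_at x0 t _ path id) => _ q; exact: measurable_coord.
Qed.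

Lemma measurable_upd t :
  measurable_fun setT (fun by_ : path * measurableTypeR R => upd t by_.2 by_.1).
Proof.
apply: measurable_fun_path => i; rewrite /upd; case: eqP => [it|it].
  rewrite -[X in measurable X]setTI; apply: measurable_fun_le => //.
rewrite -[X in measurable X]setTI.
exact: (@measurable_fst _ _ path R measurableT _ (measurable_coord i)).
Qed.

Lemma value_at_upd x0 t y b : 0 < t -> value_at x0 t (upd t y b) = y.
Proof.
move=> t0; rewrite /value_at leNgt t0 /=.
suff -> : ereal_inf [set (ratr q)%:E | q in [set q | upd t y b (t, q)]] = y%:E by [].
apply/eqP; rewrite eq_le; apply/andP; split.
  apply/lee_addgt0Pr => e e0.
  have : y < y + e by rewrite ltrDl.
  move=> /rat_in_itvoo[q]; rewrite in_itv/= => /andP[yq qe].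
  apply: le_trans (_ : (ratr q)%:E <= _)%E.
    by apply: ereal_inf_lbound; exists q => //=; rewrite /upd eqxx ltW.
  by rewrite -EFinD lee_fin ltW.
apply: le_ereal_inf_tmp => _ [q /= + <-].
by rewrite /upd eqxx lee_fin.
Qed.

Definition agree_off t b b' := forall i, i.1 != t -> b i = b' i.

Lemma agree_off_sym t b b' : agree_off t b b' -> agree_off t b' b.
Proof. by move=> bb' i it; rewrite bb'. Qed.

Lemma value_at_agree_off x0 t u b b' : agree_off u b b' -> t != u ->
  value_at x0 t b = value_at x0 t b'.
Proof.
move=> bb' tu; rewrite /value_at; case: ifPn => // _; congr (fine (ereal_inf _)).
by apply/seteqP; split => _ [q /= bq <-]; exists q => //=; move: bq; rewrite (bb' (t, q)).
Qed.

Lemma agree_off_upd t y b : agree_off t b (upd t y b).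
Proof. by move=> i it; rewrite /upd (negbTE it). Qed.

Lemma upd_agree_off t u y b b' : agree_off u b b' ->
  agree_off u (upd t y b) (upd t y b').
Proof. by move=> bb' i iu; rewrite /upd; case: ifP => // _; exact: bb'. Qed.

(** Set-theoretic independence: membership in [C] ignores the bits of time [t]. No probability is
    involved. *)
Definition indep t (C : set path) := forall b b', agree_off t b b' -> C b -> C b'.

End path_space.

(** * Markov processes with given transition kernels *)

Section chain.
Local Open Scope ereal_scope.
Variables (R : realType) (x0 : R)
  (p : R -> R -> R.-pker (measurableTypeR R) ~> (measurableTypeR R)).
Hypothesis chapman_kolmogorov : forall (s t u : R) x A, (0 <= s)%R -> (s < t)%R ->
  (t < u)%R -> measurable A -> \int[p s t x]_y p t u y A = p s u x A.

Local Notation path := (bpath (R * rat)%type).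
Local Notation value_at := (value_at x0).

Definition step s t : R.-pker path ~> measurableTypeR R := kprecomp (p s t) (measurable_value_atT x0 s).

(** Law of the path obtained from [b] by drawing, at each time of [l] in turn, a value from the one
    stored at the preceding time and writing its bits. All other bits are kept from [b], so chains
    along different lists are measures on one space and can be compared. *)
Fixpoint chain (l : seq R) (s : R) : R.-pker path ~> path :=
  if l is t :: l' then
    mkcomp (step s t) (kprecomp (chain l' t) (@measurable_upd R t))
  else kdirac (@measurable_id _ path setT).

Lemma chain_cons t l s b C :
  chain (t :: l) s b C = \int[p s t (value_at s b)]_y chain l t (upd t y b) C.
Proof. by []. Qed.

Lemma ge0_integral_chain_cons t l s b (f : path -> \bar R) :
  (forall w, 0 <= f w) -> measurable_fun setT f ->
  \int[chain (t :: l) s b]_w f w =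
  \int[p s t (value_at s b)]_y \int[chain l t (upd t y b)]_w f w.
Proof. by move=> f0 mf; exact: integral_kcomp. Qed.

Lemma measurable_upd2 (t : R) (b : path) :
  measurable_fun setT (fun y : measurableTypeR R => upd t y b).
Proof. exact: (measurableT_comp (measurable_upd t) (pair1_measurable b)). Qed.

Lemma measurable_chain l t b C : measurable C ->
  measurable_fun setT (fun y => chain l t (upd t y b) C).
Proof.
by move=> mC; exact: (measurableT_comp (measurable_kernel (chain l t) C mC) (measurable_upd2 t b)).
Qed.

Lemma ge0_integral_chapman_kolmogorov s t u x (f : R -> \bar R) :
  (0 <= s)%R -> (s < t)%R -> (t < u)%R -> (forall y, 0 <= f y) ->
  measurable_fun setT f ->
  \int[p s t x]_y \int[p t u y]_z f z = \int[p s u x]_z f z.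
Proof.
move=> s0 st tu f0 mf.
pose k : R.-pker (measurableTypeR R * measurableTypeR R) ~> measurableTypeR R :=
  kprecomp (p t u) measurable_snd.
rewrite -(@integral_kcomp _ _ _ _ _ _ _ (p s t) k)//.
by apply: eq_measure_integral => A mA _; exact: chapman_kolmogorov.
Qed.

(** The bits of [t] are not read by the chain, since [t] is neither [s] nor in [l], and [C] does not
    look at them. *)
Lemma chain_agree_off (t : R) (l : seq R) (s : R) b b' C : t \notin l -> t != s -> measurable C ->
  indep t C -> agree_off t b b' -> chain l s b C = chain l s b' C.
Proof.
move=> + + mC iC; elim: l s b b' => [|u l IH] s b b' tl ts bb'.
  rewrite /= /kdirac/= !diracE; congr (_%:R%:E); congr nat_of_bool.
  apply/idP/idP; rewrite !inE; first exact: iC.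
  exact/iC/agree_off_sym.
move: tl; rewrite inE negb_or => /andP[tu tl].
rewrite !chain_cons (value_at_agree_off x0 bb') 1?eq_sym//.
by apply: eq_integral => y _; apply: IH => //; exact: upd_agree_off.
Qed.

(** If a later time follows [t], skipping [t] is the Chapman-Kolmogorov equation; if [t] is the last
    time, its draw is invisible to [C] and integrates to 1. *)
Lemma chain_remove (t : R) (l : seq R) (s : R) b C : (0 <= s)%R -> path.path <%R s (t :: l) ->
  measurable C -> indep t C -> chain (t :: l) s b C = chain l s b C.
Proof.
move=> s0 stl mC iC; have /andP[st tl] : ((s < t) && path.path <%R t l)%R by [].
have tNl : t \notin l.
  apply/negP => tl'; have := order_path_min lt_trans tl.
  by move=> /allP/(_ _ tl'); rewrite ltxx.
have t0 : (0 < t)%R by exact: le_lt_trans st.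
case: l {stl} tl tNl => [_ _|u l tul]; last have /andP[tu ul] : ((t < u) && path.path <%R u l)%R by [].
  rewrite chain_cons (_ : (fun y => _) = cst (chain [::] s b C)); last first.
    apply/funext => y /=; rewrite /kdirac/= !diracE.
    congr (_%:R%:E); congr nat_of_bool.
    apply/idP/idP; rewrite !inE; apply: iC; last exact: agree_off_upd.
    exact/agree_off_sym/agree_off_upd.
  by rewrite integral_cst// prob_kernel mule1.
rewrite inE negb_or => /andP[tu' tNl].
rewrite !chain_cons.
rewrite -(ge0_integral_chapman_kolmogorov _ s0 st tu)//; last exact: measurable_chain.
apply: eq_integral => y _; rewrite chain_cons value_at_upd//.
(* Both paths hold [z] at time [u]; they differ only at [t], where one holds [y] and the other the
   bits of [b]. *)
apply: eq_integral => z _; apply: (chain_agree_off tNl) => //.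
exact/upd_agree_off/agree_off_sym/agree_off_upd.
Qed.

(** Kolmogorov consistency. Times that [C] does not see are dropped first in the tail, under the
    integral, and then at the head by [chain_remove]. *)
Lemma chain_subseq (l l' : seq R) (s : R) b C : (0 <= s)%R -> path.path <%R s l' -> subseq l l' ->
  measurable C -> (forall t, t \in l' -> t \notin l -> indep t C) ->
  chain l' s b C = chain l s b C.
Proof.
move=> + + + mC; elim: l' l s b => [|t l' IH] l s b s0.
  by move=> _; rewrite subseq0 => /eqP ->.
move=> sl'; have /andP[st tl'] : ((s < t) && path.path <%R t l')%R by [].
have tNl' : t \notin l'.
  apply/negP => tl; have := order_path_min lt_trans tl'.
  by move=> /allP/(_ _ tl); rewrite ltxx.
have ts0 : (0 <= t)%R by exact/ltW/(le_lt_trans s0).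
have step l1 : subseq l1 l' ->
    (forall u, u \in l' -> u \notin l1 -> indep u C) ->
    chain (t :: l') s b C = chain (t :: l1) s b C.
  move=> l1l' iC; rewrite !chain_cons; apply: eq_integral => y _.
  exact: IH.
case: l => [_ iC|u l].
  rewrite (step [::]) ?sub0seq//; last first.
    by move=> u ul _; apply: iC => //; rewrite inE ul orbT.
  by apply: chain_remove => //=; [rewrite st|exact: iC (mem_head _ _) _].
rewrite [subseq _ _]/=; case: eqP => [-> ll' iC|_ ll' iC].
  apply: step => // v vl vNl; apply: iC; first by rewrite inE vl orbT.
  rewrite inE negb_or vNl andbT; apply/eqP => vt.
  by move: tNl'; rewrite -vt vl.
rewrite (step (u :: l))//; last first.
  by move=> v vl; apply: iC; rewrite inE vl orbT.
apply: chain_remove => //.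
  rewrite /= st /=; exact: (subseq_path lt_trans ll').
apply: iC; first exact: mem_head.
by apply: contra tNl'; exact: mem_subseq.
Qed.

End chain.

(** * Finite sets of times as increasing lists *)

Section sorted_times.
Variable R : realType.
Implicit Types (l : seq R).

(** Nonpositive times are discarded, because no value is ever drawn there. *)
Definition sorted_times l := sort <=%R (undup [seq t <- l | 0 < t]).

Lemma mem_sorted_times l t : (t \in sorted_times l) = (0 < t) && (t \in l).
Proof. by rewrite mem_sort mem_undup mem_filter. Qed.

Lemma sorted_times_sorted l : sorted <%R (sorted_times l).
Proof. by rewrite sort_lt_sorted undup_uniq. Qed.

Lemma sorted_times_path l : path.path <%R 0 (sorted_times l).
Proof.
rewrite path_min_sorted ?sorted_times_sorted//.
by apply/allP => t; rewrite mem_sorted_times => /andP[].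
Qed.

Lemma sorted_times_id l : path.path <%R 0 l -> sorted_times l = l.
Proof.
move=> pl; apply: lt_sorted_eq; [exact: sorted_times_sorted|exact: path_sorted pl|].
move=> t; rewrite mem_sorted_times; case: (boolP (t \in l)); rewrite ?andbF// => tl.
by have /allP/(_ _ tl) -> := order_path_min lt_trans pl.
Qed.

Lemma subseq_sorted_times l l' : {subset l <= l'} -> subseq (sorted_times l) (sorted_times l').
Proof.
move=> ll'; suff -> : sorted_times l = [seq t <- sorted_times l' | t \in l].
  exact: filter_subseq.
apply: lt_sorted_eq; first exact: sorted_times_sorted.
  exact/lt_sorted_filter/sorted_times_sorted.
move=> t; rewrite mem_filter !mem_sorted_times; case: (boolP (t \in l)).
  by move=> /ll' ->; rewrite andbT.
by rewrite andbF.
Qed.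

(** A history up to [s] may not mention [s], yet the next draw starts from the value at [s]. The
    list of times is completed so as to end there; for [s = 0] it is empty and [last] returns its
    default 0. *)
Lemma exists_last_time (l : seq R) (s : R) : 0 <= s ->
  (forall u, u \in l -> u <= s) ->
  exists l', [/\ path.path <%R 0 l', last 0 l' = s &
    forall u, u \in l -> u <= 0 \/ u \in l'].
Proof.
rewrite le_eqVlt => /predU1P[<-|s0] ls; first by exists [::]; split => // u /ls; left.
pose l0 := sorted_times [seq u <- l | u < s].
exists (rcons l0 s); split.
- rewrite rcons_path sorted_times_path/=; have := mem_last 0 l0.
  rewrite inE => /predU1P[->//|]; rewrite mem_sorted_times mem_filter.
  by move=> /andP[_ /andP[]].
- by rewrite last_rcons.
- move=> u ul; case: (leP u 0) => u0; [by left|right].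
  rewrite mem_rcons inE mem_sorted_times mem_filter u0 ul andbT /=.
  by have := ls _ ul; rewrite le_eqVlt.
Qed.

End sorted_times.

Section density_measure.
Local Open Scope ereal_scope.
Context d (T : measurableType d) (R : realType) (mu : {measure set T -> \bar R}).
Variable f : T -> \bar R.

(** The proofs about [f] are arguments so that the measure structure can be attached to this
    term. *)
Definition density_measure (f0 : forall x, 0 <= f x)
    (mf : measurable_fun setT f) (A : set T) := \int[mu]_(x in A) f x.

Variables (f0 : forall x, 0 <= f x) (mf : measurable_fun setT f).

Local Notation m := (density_measure f0 mf).

Let m0 : m set0 = 0. Proof. exact: integral_set0. Qed.

Let m_ge0 A : 0 <= m A. Proof. exact: integral_ge0. Qed.

Let m_sigma_additive : semi_sigma_additive m.
Proof.
move=> F mF tF mUF; rewrite /density_measure ge0_integral_bigcup//.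
  by apply: is_cvg_ereal_nneg_natsum_cond => n _ _; exact: integral_ge0.
exact: measurable_funTS.
Qed.

HB.instance Definition _ := isMeasure.Build _ _ _ m m0 m_ge0 m_sigma_additive.

End density_measure.

Lemma pker_le1 d d' (X : measurableType d) (Y : measurableType d')
  (R : realType) (k : R.-pker X ~> Y) x A : measurable A -> (k x A <= 1)%E.
Proof.
move=> mA; have <- : k x setT = 1%E by exact: prob_kernel.
by apply: le_measure => //; rewrite inE.
Qed.

(** * The measure on path space and its Markov property *)

Section path_measure.
Local Open Scope ereal_scope.
Variables (R : realType) (x0 : R)
  (p : R -> R -> R.-pker (measurableTypeR R) ~> (measurableTypeR R)).
Hypothesis chapman_kolmogorov : forall (s t u : R) x A, (0 <= s)%R -> (s < t)%R ->
  (t < u)%R -> measurable A -> \int[p s t x]_y p t u y A = p s u x A.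

Local Notation path := (bpath (R * rat)%type).
Local Notation value_at := (value_at x0).
Local Notation chain := (chain x0 p).
Local Notation times := (fun F : seq (R * rat) => [seq i.1 | i <- F]).

(** Bits before any draw. In [path_contentE] a cylinder over [F] meets them only at times [t <= 0],
    where [value_at] does not read them. *)
Let b0 : path := fun=> false.

Lemma depends_on_indep (F : seq (R * rat)) (C : set path) t :
  depends_on F C -> t \notin times F -> indep t C.
Proof.
move=> dC tF b b' bb'; apply: dC => i iF; apply: bb'.
by apply: contra tF => /eqP <-; exact: map_f.
Qed.

Lemma measurable_cylinder (F : seq (R * rat)) (C : set path) :
  depends_on F C -> measurable C.
Proof. by move=> dC; apply: sub_sigma_algebra; exists F. Qed.

(** The times whose bits are settled after a chain along [l] from time 0: those of [l], and the
    nonpositive ones, which keep the bits of [b0]. *)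
Definition past (l : seq R) : set R := [set u | (u <= 0)%R \/ u \in l].

Lemma chain_sorted_times F (C : set path) (l l' : seq R) : depends_on F C ->
  (forall i, i \in F -> past l i.1) -> {subset l <= l'} ->
  chain (sorted_times l') 0%R b0 C = chain (sorted_times l) 0%R b0 C.
Proof.
move=> dC Fl ll'; apply: chain_subseq => //.
- exact: sorted_times_path.
- exact: subseq_sorted_times.
- exact: measurable_cylinder dC.
- move=> t; rewrite !mem_sorted_times => /andP[t0 _]; rewrite t0 /= => tl.
  apply: depends_on_indep dC _; apply/mapP => -[i /Fl + ti].
  by rewrite -ti => -[|]; [rewrite leNgt t0|rewrite (negbTE tl)].
Qed.

(** The coordinates of a cylinder are picked by choice; [path_contentE] compares two picks through
    their concatenation. The value 0 elsewhere keeps the content nonnegative on all sets. *)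
Definition path_content (C : set path) : \bar R :=
  if pselect (@cylinder (R * rat)%type C) is left cC
  then chain (sorted_times (times (projT1 (cid cC)))) 0%R b0 C else 0.

Lemma path_contentE F C : depends_on F C ->
  path_content C = chain (sorted_times (times F)) 0%R b0 C.
Proof.
move=> dC; rewrite /path_content; case: pselect => [cC|[]]; last by exists F.
case: cid => F' /= dC'.
rewrite -(chain_sorted_times (l := times F) (l' := times (F ++ F')) dC)//; last 2 first.
- by move=> i iF; right; exact: map_f.
- by rewrite map_cat => t tF; rewrite mem_cat tF.
rewrite -(chain_sorted_times (l := times F') (l' := times (F ++ F')) dC')//.
- by move=> i iF; right; exact: map_f.
- by rewrite map_cat => t tF; rewrite mem_cat tF orbT.
Qed.

Lemma exists_path_measure : exists P : probability path R,
  forall F C, depends_on F C -> P C = chain (sorted_times (times F)) 0%R b0 C.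
Proof.
have [|||P PE] := @cylinder_extension (R * rat)%type R path_content.
- by move=> A; rewrite /path_content; case: pselect.
- by rewrite (@path_contentE [::])// prob_kernel.
(* Over a common list of coordinates the content is one chain, hence a genuine measure, and
   additivity is inherited. *)
- move=> A B cA cB AB; have [F [dA dB]] := cylinder_common cA cB.
  rewrite (path_contentE (depends_onU dA dB)) (path_contentE dA) (path_contentE dB).
  rewrite measureU//; first exact: measurable_cylinder dA.
    exact: measurable_cylinder dB.
  exact/eqP.
- exists P => F C dC; rewrite PE; last by exists F.
  exact: path_contentE.
Qed.

Definition cylinder_at (S : set R) : set (set path) :=
  [set C | exists F, depends_on F C /\ forall i, i \in F -> S i.1].

Lemma cylinder_at_sub S : cylinder_at S `<=` measurable.
Proof. by move=> C [F [dC _]]; exact: measurable_cylinder dC. Qed.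

Lemma cylinder_atI S : setI_closed (cylinder_at S).
Proof.
move=> C D [F [dC SF]] [F' [dD SF']]; exists (F ++ F'); split.
  apply: depends_onI; [apply: depends_onS dC|apply: depends_onS dD];
    by move=> i iF; rewrite mem_cat iF ?orbT.
by move=> i; rewrite mem_cat => /orP[/SF|/SF'].
Qed.

Lemma cylinder_atT S : cylinder_at S setT.
Proof. by exists [::]. Qed.

Lemma measurable_cylinder_at S C : <<s cylinder_at S >> C -> measurable C.
Proof.
move=> sC; apply: (smallest_sub _ (@cylinder_at_sub S)) sC.
exact: sigma_algebra_measurable.
Qed.

Lemma coord_cylinder_at (S : set R) t q : S t ->
  cylinder_at S [set b | b (t, q)].
Proof.
move=> St; exists [:: (t, q)]; split => [b b' bb' /=|i].
  by rewrite -bb' ?mem_head.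
by rewrite inE => /eqP ->.
Qed.

Lemma value_at_cylinder_at (S : set R) t B : (t <= 0)%R \/ S t -> measurable B ->
  <<s cylinder_at S >> (value_at t @^-1` B).
Proof.
move=> St mB; pose T := g_sigma_algebraType (cylinder_at S).
have : measurable_fun setT (fun b : T => value_at t (id b)).
  apply: measurable_value_at => t0 q; apply: sub_sigma_algebra.
  by apply: coord_cylinder_at; case: St => //; rewrite leNgt t0.
by move=> /(_ measurableT B mB); rewrite setTI.
Qed.

Section with_path_measure.
Variable P : probability path R.
Hypothesis PE : forall F C, depends_on F C ->
  P C = chain (sorted_times (times F)) 0%R b0 C.

(** On cylinders this is consistency. The pi-system argument extends it to events about [value_at],
    which see infinitely many bits. *)
Lemma path_measure_chain (l : seq R) C : path.path <%R 0%R l ->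
  <<s cylinder_at (past l) >> C -> P C = chain l 0%R b0 C.
Proof.
move=> pl; apply: (g_sigma_algebra_measure_unique (cylinder_at (past l)) _ (fun=> setT)) => //.
- exact: cylinder_at_sub.
- by move=> _; exact: cylinder_atT.
- by rewrite bigcup_const.
- exact: cylinder_atI.
- move=> A [F [dA Fl]]; rewrite [LHS](PE dA) -[in RHS](sorted_times_id pl).
  rewrite -(chain_sorted_times (l := times F) (l' := times F ++ l) dA)//; last 2 first.
  + by move=> i iF; right; exact: map_f.
  + by move=> t tF; rewrite mem_cat tF.
  by apply: chain_sorted_times dA Fl _ => t tl; rewrite mem_cat tl orbT.
- by move=> _; rewrite [X in X < _](probability_setT P) ltry.
Qed.

Lemma measurable_path_ker s t (A : set R) : measurable A ->
  measurable_fun setT (fun w : path => p s t (value_at s w) A).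
Proof.
move=> mA.
exact: (measurableT_comp (measurable_kernel (p s t) A mA) (measurable_value_atT x0 s)).
Qed.

(** Since [C] ignores the bits of [t], only the event at time [t] feels the last draw, whose law is
    the kernel started at the value stored at the last time before [t]. *)
Lemma chain_rcons (l : seq R) (s t : R) b C A : (0 <= s)%R ->
  path.path <%R s (rcons l t) -> measurable C -> indep t C -> measurable A ->
  chain (rcons l t) s b (C `&` value_at t @^-1` A) =
  \int[chain l s b]_(w in C) p (last s l) t (value_at (last s l) w) A.
Proof.
move=> + + mC iC mA; elim: l s b => [|u l IH] s b s0 stl.
  have /andP[st _] : ((s < t)%R && true) by [].
  have t0 : (0 < t)%R by exact: le_lt_trans st.
  rewrite [rcons _ _]/= [last _ _]/= chain_cons.
  rewrite [RHS]integral_mkcond [RHS]integral_dirac//; last first.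
    apply/(measurable_restrictT _ mC)/measurable_funTS.
    exact: measurable_path_ker.
  rewrite [in RHS]diracT mul1e patchE.
  under eq_integral do rewrite [chain _ _ _ _]diracE.
  have [bC|bC] := boolP (b \in C); last first.
    apply: integral0_eq => y _; rewrite memNset// => -[Cb _].
    move/negP: bC; apply; apply: mem_set; apply: iC Cb.
    exact/agree_off_sym/agree_off_upd.
  rewrite -[in RHS](setIT A) -integral_indic//.
  apply: eq_integral => y _; rewrite indicE; congr (_%:R%:E); congr nat_of_bool.
  apply/idP/idP; rewrite !inE /= value_at_upd//; first by case.
  move=> Ay; split => //; apply: iC (set_mem bC); exact: agree_off_upd.
have /andP[su ult] : ((s < u)%R && path.path <%R u (rcons l t)) by [].
have u0 : (0 < u)%R by exact: le_lt_trans su.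
rewrite [rcons _ _]/= [last _ _]/= chain_cons [RHS]integral_mkcond.
rewrite ge0_integral_chain_cons//; last 2 first.
- by move=> w; apply: erestrict_ge0 => {}w _.
- by apply/(measurable_restrictT _ mC)/measurable_funTS; exact: measurable_path_ker.
apply: eq_integral => y _; rewrite IH ?(ltW u0)//.
by rewrite [LHS]integral_mkcond.
Qed.

(** The two measures are known to agree only on the history of [l], so both are pushed by the
    identity to that smaller sigma-algebra before integrating. *)
Lemma integral_path_measure_chain (l : seq R) (f : path -> \bar R) :
  path.path <%R 0%R l -> (forall w, 0 <= f w) ->
  measurable_fun [set: g_sigma_algebraType (cylinder_at (past l))] f ->
  \int[P]_w f w = \int[chain l 0%R b0]_w f w.
Proof.
move=> pl f0 mf; pose T := g_sigma_algebraType (cylinder_at (past l)).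
pose j : path -> T := id.
have mj : measurable_fun setT j.
  by move=> _ B mB; rewrite setTI; exact: measurable_cylinder_at mB.
transitivity (\int[pushforward P j]_w (f : T -> \bar R) w).
  by rewrite ge0_integral_pushforward.
transitivity (\int[pushforward (chain l 0%R b0) j]_w (f : T -> \bar R) w).
  apply: eq_measure_integral => A mA _.
  exact: path_measure_chain.
by rewrite ge0_integral_pushforward.
Qed.

(** As functions of [C] both sides are finite measures, one given by a density and one a restriction
    of [P]; it is enough to compare them on cylinders up to time [s]. *)
Lemma path_measure_markov (s t : R) (C : set path) A : (0 <= s)%R -> (s < t)%R ->
  <<s cylinder_at [set u | (u <= s)%R] >> C -> measurable A ->
  \int[P]_(w in C) p s t (value_at s w) A = P (C `&` value_at t @^-1` A).
Proof.
move=> s0 st sC mA.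
have t0 : (0 < t)%R by exact: le_lt_trans st.
have mXA : measurable (value_at t @^-1` A).
  by rewrite -[X in measurable X]setTI; exact: measurable_value_atT.
have p0 w : 0 <= p s t (value_at s w) A by [].
rewrite -[LHS]/(density_measure P p0 (measurable_path_ker s t mA) C).
rewrite -[RHS]/(mrestr P mXA C).
apply: (g_sigma_algebra_measure_unique (cylinder_at [set u | (u <= s)%R]) _
  (fun=> setT)) sC => //.
- exact: cylinder_at_sub.
- by move=> _; exact: cylinder_atT.
- by rewrite bigcup_const.
- exact: cylinder_atI.
- move=> D [F [dD Fs]].
  change (\int[P]_(w in D) p s t (value_at s w) A = P (D `&` value_at t @^-1` A)).
  have [|l [pl ls Fl]] := @exists_last_time R (times F) s s0.
    by move=> u /mapP[i iF ->]; exact: Fs.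
  have pDl : cylinder_at (past l) D.
    by exists F; split => // i iF; apply: Fl; exact: map_f.
  have plt : path.path <%R 0%R (rcons l t) by rewrite rcons_path pl/= ls.
  have mD := measurable_cylinder dD.
  rewrite (@path_measure_chain (rcons l t))//; last first.
    pose T := g_sigma_algebraType (cylinder_at (past (rcons l t))).
    apply: (@measurableI _ T).
      apply: sub_sigma_algebra; exists F; split => // i iF.
      have [|il] := Fl i.1 (map_f _ iF); [by left|right].
      by rewrite mem_rcons inE il orbT.
    by apply: value_at_cylinder_at => //; right; right; rewrite mem_rcons mem_head.
  rewrite chain_rcons//; last first.
    apply: depends_on_indep dD _; apply/mapP => -[i /Fs /= + ti].
    by rewrite -ti leNgt st.
  rewrite ls [LHS]integral_mkcond [RHS]integral_mkcond.
  apply: integral_path_measure_chain => //.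
    by move=> w; apply: erestrict_ge0 => {}w _.
  pose T := g_sigma_algebraType (cylinder_at (past l)).
  apply/(@measurable_restrictT _ _ T _ D); first exact: sub_sigma_algebra.
  apply: measurable_funTS.
  have mv : measurable_fun [set: T] (value_at s : T -> measurableTypeR R).
    move=> _ B mB; rewrite setTI; apply: value_at_cylinder_at => //.
    have := mem_last 0%R l; rewrite ls inE => /predU1P[->|sl]; first by left.
    by right; right.
  exact: (measurableT_comp (measurable_kernel (p s t) A mA) mv).
- move=> _; apply: le_lt_trans (_ : 1 < +oo); last exact: ltry.
  change (\int[P]_w p s t (value_at s w) A <= 1).
  apply: le_trans (_ : \int[P]_w cst 1 w <= 1).
    apply: ge0_le_integral => //; first exact: measurable_path_ker.
    by move=> w _; exact: pker_le1.
  by rewrite integral_cst// mul1e; exact: probability_le1.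
Qed.

End with_path_measure.
End path_measure.

Section markov_existence.
Local Open Scope ereal_scope.

Theorem markov_process_exists (R : realType) (x0 : R)
    (p : R -> R -> R.-pker (measurableTypeR R) ~> (measurableTypeR R)) :
  (forall (s t u : R) x A, (0 <= s)%R -> (s < t)%R -> (t < u)%R ->
    measurable A -> \int[p s t x]_y p t u y A = p s u x A) ->
  exists (d : measure_display) (Omega : measurableType d)
    (P : probability Omega R) (X : R -> {RV P >-> R}),
    (forall w, X 0%R w = x0) /\
    (forall (s t : R) A, (0 <= s)%R -> (s < t)%R -> measurable A ->
      is_cond_expectation P (natural_filtration X s)
        (fun w => (\1_(X t @^-1` A) w)%:E) (fun w => p s t (X s w) A)).
Proof.
move=> ck; have [P PE] := exists_path_measure x0 ck.
pose X (t : R) : {RV P >-> R} := mfun_Sub (mem_set (measurable_value_atT x0 t)).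
exists _, _, P, X; split; first by move=> w; rewrite /X/= /value_at lexx.
move=> s t A s0 st mA.
have mp : measurable_fun setT (fun w => p s t (X s w) A).
  exact: measurable_path_ker.
split.
- move=> B mB; apply: sub_sigma_algebra.
  exists s, ((fun y => p s t y A) @^-1` B); split => //.
    by rewrite s0 lexx.
  by rewrite -[X in measurable X]setTI; exact: (measurable_kernel (p s t) A mA).
- apply: (@le_integrable _ _ _ P setT measurableT _ (cst 1)) => //.
    move=> w _; rewrite !gee0_abs//=.
    exact: pker_le1.
  exact: finite_measure_integrable_cst.
- move=> C FC.
  (* The values up to time [s] are functions of the bits up to [s], so the natural filtration is
     contained in the history generated by these bits. *)
  have sC : <<s cylinder_at [set u | (u <= s)%R] >> C.
    apply: smallest_sub FC; first exact: smallest_sigma_algebra.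
    move=> _ [u [B [/andP[u0 us] mB ->]]].
    by apply: value_at_cylinder_at => //; right.
  rewrite (path_measure_markov ck PE s0 st sC mA) integral_indic//.
  - by rewrite setIC.
  - exact: measurable_cylinder_at sC.
  - by rewrite -[X in measurable X]setTI; exact: measurable_value_atT.
Qed.

End markov_existence.

(** * Gaussian laws and their mixtures *)

Section integral_density.
Local Open Scope ereal_scope.
Context d (T : measurableType d) (R : realType) (mu : {measure set T -> \bar R}).
Variable f : T -> \bar R.
Variables (f0 : forall x, 0 <= f x) (mf : measurable_fun setT f).
Hypothesis ffin : forall x, f x \is a fin_num.
Local Notation m := (density_measure mu f0 mf).

Import HBNNSimple.

Let integral_density_indic E : measurable E ->
  \int[m]_x (\1_E x)%:E = \int[mu]_x ((\1_E x)%:E * f x).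
Proof.
move=> mE; rewrite integral_indic// setIT /= /density_measure.
rewrite integral_mkcond; apply: eq_integral => x _.
rewrite patchE indicE; case: (x \in E); by rewrite ?mul1e ?mul0e.
Qed.

Let integral_density_nnsfun (g : {nnsfun T >-> R}) :
  \int[m]_x (g x)%:E = \int[mu]_x ((g x)%:E * f x).
Proof.
under [in LHS]eq_integral do rewrite fimfunE -fsumEFin//.
rewrite ge0_integral_fsum//; last 2 first.
  - by move=> r; exact/measurable_EFinP/measurableT_comp.
  - by move=> r z _; rewrite EFinM nnfun_muleindic_ge0.
transitivity (\int[mu]_x (\sum_(r \in range g) ((r * \1_(g @^-1` [set r]) x)%:E * f x))).
  rewrite ge0_integral_fsum//; last 2 first.
  - move=> r; apply: emeasurable_funM => //.
    exact/measurable_EFinP/measurableT_comp.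
  - by move=> r x _; rewrite mule_ge0// EFinM nnfun_muleindic_ge0.
  apply: eq_fsbigr => r _.
  rewrite (integralZl_indic _ (fun r => g @^-1` [set r]))//; last first.
    by move=> r0; rewrite preimage_nnfun0.
  rewrite integral_density_indic//.
  under [in RHS]eq_integral do rewrite EFinM -muleA.
  have [r0|r0] := leP 0%R r.
    rewrite ge0_integralZl//.
    - apply: emeasurable_funM => //.
      exact/measurable_EFinP.
    - by move=> x _; rewrite mule_ge0// lee_fin.
  rewrite preimage_nnfun0//.
  by rewrite !integral0_eq ?mule0// => x _; rewrite indic0 mul0e ?mule0.
apply: eq_integral => x _.
rewrite -ge0_mule_fsuml; last by move=> r; rewrite EFinM nnfun_muleindic_ge0.
by rewrite [in RHS]fimfunE -fsumEFin.
Qed.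

(** Indicators, then simple functions, then monotone limits; finiteness of [f] lets the limit pass
    through the factor [f x]. *)
Lemma ge0_integral_density (g : T -> \bar R) : (forall x, 0 <= g x) ->
  measurable_fun setT g -> \int[m]_x g x = \int[mu]_x (g x * f x).
Proof.
move=> g0 mg; pose g_ := nnsfun_approx measurableT mg.
have gE x : g x = lim ((g_ n x)%:E @[n --> \oo]).
  by apply/esym/cvg_lim => //; exact: cvg_nnsfun_approx.
transitivity (lim (\int[m]_x (g_ n x)%:E @[n --> \oo])).
  rewrite -monotone_convergence//=.
  - by apply: eq_integral => x _; exact: gE.
  - by move=> n; exact/measurable_EFinP.
  - by move=> n x _; rewrite lee_fin.
  - by move=> x _ a b ab; rewrite lee_fin; exact/lefP/nd_nnsfun_approx.
under eq_fun do rewrite integral_density_nnsfun.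
rewrite -monotone_convergence//=.
- apply: eq_integral => x _; apply/cvg_lim => //; apply: cvgeZr => //.
  exact: cvg_nnsfun_approx.
- by move=> n; apply: emeasurable_funM => //; exact/measurable_EFinP.
- by move=> n x _; apply: mule_ge0; rewrite ?lee_fin.
- move=> x _ a b ab; apply: lee_wpmul2r => //.
  by rewrite lee_fin; exact/lefP/nd_nnsfun_approx.
Qed.

End integral_density.

Lemma ge0_integral_normal_prob (R : realType) (m s : R) (g : R -> \bar R) :
  (forall x, 0 <= g x)%E -> measurable_fun setT g ->
  (\int[normal_prob m s]_x g x =
   \int[lebesgue_measure]_x (g x * (normal_pdf m s x)%:E))%E.
Proof.
move=> g0 mg.
have p0 x : (0 <= (normal_pdf m s x)%:E)%E by rewrite lee_fin normal_pdf_ge0.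
have mp : measurable_fun setT (fun x => (normal_pdf m s x)%:E).
  by apply/measurable_EFinP; exact: measurable_normal_pdf.
by rewrite -(ge0_integral_density lebesgue_measure p0 mp).
Qed.

(** Completing the square in [y]. For Y of law N(m, s^2) and Z equal to a Y plus an independent N(0,
    w^2), the joint density is rewritten as the density of Z times the conditional density of Y
    given Z. *)
Lemma normal_pdf_mul (R : realType) (m s a w y z : R) : 0 < s -> 0 < w ->
  let t := Num.sqrt (a ^+ 2 * s ^+ 2 + w ^+ 2) in
  normal_pdf m s y * normal_pdf (a * y) w z =
  normal_pdf (a * m) t z *
  normal_pdf ((m * w ^+ 2 + a * s ^+ 2 * z) / t ^+ 2) (s * w / t) y.
Proof.
move=> s0 w0 t.
have T0 : 0 < a ^+ 2 * s ^+ 2 + w ^+ 2.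
  by rewrite ltr_wpDl ?exprn_gt0// mulr_ge0 ?sqr_ge0.
have t0 : 0 < t by rewrite sqrtr_gt0.
have t2 : t ^+ 2 = a ^+ 2 * s ^+ 2 + w ^+ 2 by rewrite sqr_sqrtr// ltW.
have sw0 : 0 < s * w / t by rewrite divr_gt0// mulr_gt0.
rewrite !normal_pdfE ?gt_eqF// /normal_peak /normal_fun.
rewrite mulrACA [RHS]mulrACA -!expRD; congr (_ * _).
  rewrite -!invfM; congr (_^-1).
  rewrite -!sqrtrM ?mulrn_wge0 ?mulr_ge0 ?sqr_ge0 ?pi_ge0 ?ltW//.
  congr Num.sqrt; rewrite expr_div_n.
  by field; rewrite gt_eqF.
congr expR; rewrite expr_div_n t2.
by field; rewrite exprMn !gt_eqF.
Qed.

(** The formula with [powR] also holds at 0, where both sides vanish. *)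
Lemma measurable_inv (R : realType) : measurable_fun [set: R] (@GRing.inv R).
Proof.
have -> : @GRing.inv R = fun x => x * (x ^+ 2) `^ (-1).
  apply/funext => x; rewrite powR_inv1 ?sqr_ge0//.
  have [->|x0] := eqVneq x 0; first by rewrite mul0r invr0.
  by rewrite expr2 invfM mulrA divff// mul1r.
apply: measurable_funM => //.
apply: (measurableT_comp (measurable_powR (-1))); exact: measurable_funX.
Qed.

Section gauss.
Variable R : realType.
Local Notation mR := (measurableTypeR R).
Local Notation leb := (@lebesgue_measure R).

(** Here [v] is the variance. For [v < 0], met below when r > 1, the deviation [Num.sqrt v] is 0 and
    the value is a conventional law, still a probability. *)
Definition gauss (m v : R) : probability mR R :=
  if v == 0 then (@dirac _ mR m R : probability mR R)
  else (normal_prob m (Num.sqrt v) : probability mR R).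

Lemma gauss0 m A : gauss m 0 A = \d_m A.
Proof. by rewrite /gauss eqxx. Qed.

Lemma gauss_neq0 m v A : v != 0 -> gauss m v A = normal_prob m (Num.sqrt v) A.
Proof. by rewrite /gauss => /negbTE ->. Qed.

Lemma gauss_lawE m v A : gauss_law m v A = gauss m v A.
Proof. by rewrite /gauss_law /gauss; case: ifP. Qed.

Opaque gauss.

Lemma integral_gauss0 (m : R) (f : mR -> \bar R) : measurable_fun setT f ->
  (\int[gauss m 0]_y f y = f m)%E.
Proof.
move=> mf; transitivity (\int[@dirac _ mR m R]_y f y)%E.
  by apply: eq_measure_integral => A mA _; exact: gauss0.
by rewrite integral_dirac// diracT mul1e.
Qed.

Lemma integral_gauss_normal (m v : R) (f : mR -> \bar R) : 0 < v ->
  (\int[gauss m v]_y f y = \int[normal_prob m (Num.sqrt v)]_y f y)%E.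
Proof.
move=> v0; apply: eq_measure_integral => A mA _.
by apply: gauss_neq0; rewrite gt_eqF.
Qed.

Lemma measurable_normal_pdf3 :
  measurable_fun setT (fun q : mR * mR * mR => normal_pdf q.1.1 q.1.2 q.2).
Proof.
have ms : measurable_fun setT (fun q : mR * mR * mR => q.1.2 : mR).
  exact: (measurableT_comp measurable_snd measurable_fst).
have mm : measurable_fun setT (fun q : mR * mR * mR => q.1.1 : mR).
  exact: (measurableT_comp measurable_fst measurable_fst).
rewrite /normal_pdf; apply: measurable_fun_ifT => //=.
- by apply: measurable_fun_eqr => //; exact: ms.
- apply: (@measurableT_comp _ _ _ _ _ _ (\1_`[0%R, 1%R] : mR -> mR) _ snd) => //.
- apply: measurable_funM.
    rewrite /normal_peak; apply: (measurableT_comp (@measurable_inv R)).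
    apply: (measurableT_comp (continuous_measurable_fun (@sqrt_continuous R))).
    under eq_fun do rewrite -mulr_natr.
    by apply: measurable_funM => //; apply: measurable_funM => //; exact: measurable_funX.
  rewrite /normal_fun; apply: (measurableT_comp (@measurable_expR R)).
  apply: measurable_funM.
    apply: (measurableT_comp (@oppr_measurable R setT)).
    by apply: measurable_funX; apply: measurable_funB => //; exact: mm.
  apply: (measurableT_comp (@measurable_inv R)).
  under eq_fun do rewrite -mulr_natr.
  by apply: measurable_funM => //; exact: measurable_funX.
Qed.

Lemma measurable_fun_normal_pdf d (T : measurableType d) (f g h : T -> mR) :
  measurable_fun setT f -> measurable_fun setT g -> measurable_fun setT h ->
  measurable_fun setT (fun x => normal_pdf (f x) (g x) (h x)).
Proof.
move=> mf mg mh.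
have mfgh : measurable_fun setT (fun x => (f x, g x, h x)).
  by apply: measurable_fun_pair => //; exact: measurable_fun_pair.
exact: (measurableT_comp measurable_normal_pdf3 mfgh).
Qed.

(** Mean and variance both become variables of a kernel, hence joint measurability. The
    nondegenerate part is an integral with parameters, covered by Tonelli's theorem. *)
Lemma measurable_gauss A : measurable A ->
  measurable_fun setT (fun q : mR * mR => gauss q.1 q.2 A).
Proof.
move=> mA.
have -> : (fun q : mR * mR => gauss q.1 q.2 A) = (fun q : mR * mR =>
    if q.2 == (0 : R)%R then \d_(q.1) A else
    \int[leb]_y (\1_A y * normal_pdf q.1 (Num.sqrt q.2) y)%:E)%E.
  apply/funext => q; have [->|q0] := eqVneq q.2 0; first exact: gauss0.
  rewrite gauss_neq0// /normal_prob integral_mkcond; apply: eq_integral => y _.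
  by rewrite patchE indicE; case: ifP; rewrite ?mul1r ?mul0r.
have mI : measurable_fun setT (\1_A : mR -> R) by exact: measurable_indic.
apply: measurable_fun_ifT => //=.
- exact: measurable_fun_eqr.
- have md : measurable_fun setT (fun x : mR => \d_x A : \bar R).
    exact: measurable_fun_dirac.
  exact: (measurableT_comp md measurable_fst).
- pose f (z : mR * mR * mR) : \bar R :=
    (\1_A z.2 * normal_pdf z.1.1 (Num.sqrt z.1.2) z.2)%:E.
  apply: (@measurable_fun_fubini_tonelli_F _ _ _ _ _ leb f).
  + apply/measurable_EFinP; apply: measurable_funM.
      exact: (measurableT_comp mI measurable_snd).
    apply: measurable_fun_normal_pdf => //.
      exact: (measurableT_comp measurable_fst measurable_fst).
    apply: (measurableT_comp (continuous_measurable_fun (@sqrt_continuous R))).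
    exact: (measurableT_comp measurable_snd measurable_fst).
  + by move=> z; rewrite /f lee_fin mulr_ge0// normal_pdf_ge0.
Qed.

Lemma measurable_fun_gauss d (T : measurableType d) (f g : T -> mR) A :
  measurable_fun setT f -> measurable_fun setT g -> measurable A ->
  measurable_fun setT (fun x => gauss (f x) (g x) A).
Proof.
move=> mf mg mA; have mfg : measurable_fun setT (fun x => (f x, g x)).
  exact: measurable_fun_pair.
exact: (measurableT_comp (measurable_gauss mA) mfg).
Qed.

Lemma measurable_normal_prob1 (a w : R) A : 0 < w -> measurable A ->
  measurable_fun setT (fun y : mR => normal_prob (a * y) w A).
Proof.
move=> w0 mA; have -> : (fun y : mR => normal_prob (a * y) w A) =
    (fun y => gauss (a * y) (w ^+ 2) A).
  apply/funext => y; rewrite gauss_neq0 ?sqrtr_sqr ?gtr0_norm//.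
  by rewrite sqrf_eq0 gt_eqF.
by apply: measurable_fun_gauss => //; exact: measurable_funM.
Qed.

(** After Tonelli and [normal_pdf_mul], the inner integral is that of a conditional density, hence
    1, and the density of the convolution remains. *)
Lemma normal_prob_convolution (m s a w : R) A : 0 < s -> 0 < w -> measurable A ->
  (\int[normal_prob m s]_y normal_prob (a * y) w A =
   normal_prob (a * m) (Num.sqrt (a ^+ 2 * s ^+ 2 + w ^+ 2)) A)%E.
Proof.
move=> s0 w0 mA; set t := Num.sqrt _.
pose f (z : mR * mR) : \bar R :=
  (\1_A z.2 * (normal_pdf m s z.1 * normal_pdf (a * z.1) w z.2))%:E.
have mI : measurable_fun setT (\1_A : mR -> R) by exact: measurable_indic.
have f0 z : (0 <= f z)%E.
  by rewrite lee_fin !mulr_ge0// normal_pdf_ge0.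
have mf : measurable_fun setT f.
  apply/measurable_EFinP; apply: measurable_funM.
    exact: (measurableT_comp mI measurable_snd).
  apply: measurable_funM.
    exact: (measurableT_comp (measurable_normal_pdf m s) measurable_fst).
  by apply: measurable_fun_normal_pdf => //; exact: measurable_funM.
transitivity (\int[leb]_y \int[leb]_z f (y, z))%E.
  rewrite ge0_integral_normal_prob//; last exact: measurable_normal_prob1.
  apply: eq_integral => y _.
  rewrite /normal_prob integral_mkcond -ge0_integralZr//.
  - apply: eq_integral => z _; rewrite patchE /f indicE; case: ifP => _.
      by rewrite mul1r -EFinM mulrC.
    by rewrite mul0r mul0e.
  - apply/(measurable_restrictT _ mA)/measurable_funTS.
    by apply/measurable_EFinP; exact: measurable_normal_pdf.
  - by move=> z _; apply: erestrict_ge0 => {}z _; rewrite lee_fin normal_pdf_ge0.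
  - by rewrite lee_fin normal_pdf_ge0.
rewrite (@fubini_tonelli _ _ _ _ _ leb leb f)//.
rewrite /normal_prob [RHS]integral_mkcond; apply: eq_integral => z _.
rewrite patchE /f /= indicE; case: (z \in A); last first.
  by rewrite integral0_eq// => y _; rewrite mul0r.
under eq_integral do rewrite mul1r/= normal_pdf_mul// EFinM.
rewrite ge0_integralZl_EFin ?normal_pdf_ge0//.
- by rewrite integral_normal_pdf mule1.
- by move=> y _; rewrite lee_fin normal_pdf_ge0.
- by apply/measurable_EFinP; exact: measurable_normal_pdf.
Qed.

(** Lebesgue measure is determined by its values on the intervals ]b, c], so the change of variables
    is checked there. *)
Lemma ge0_integral_lebesgue_scale (a : R) (g : mR -> \bar R) : 0 < a ->
  (forall x, 0 <= g x)%E -> measurable_fun setT g ->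
  (\int[leb]_x g x = a%:E * \int[leb]_x g (a * x)%R)%E.
Proof.
move=> a0 g0 mg; pose phi (x : mR) : mR := a * x.
have mphi : measurable_fun setT phi by exact: measurable_funM.
pose m : {measure set mR -> \bar R} := mscale (NngNum (ltW a0)) (pushforward leb phi).
transitivity (\int[m mphi]_x g x)%E.
  apply: eq_measure_integral => A mA _; apply/lebesgue_measure_unique => //.
  move=> _ [[b c] _ <-] /=.
  change (leb `]b, c]%classic = a%:E * leb (phi @^-1` `]b, c]%classic))%E.
  have -> : phi @^-1` `]b, c]%classic = `](a^-1 * b), (a^-1 * c)]%classic.
    by apply/seteqP; split => x /=; rewrite !in_itv/= /phi ltr_pdivrMl// ler_pdivlMl.
  rewrite !lebesgue_measure_itv/= !lte_fin ltr_pM2l ?invr_gt0//.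
  case: ifP => _; last by rewrite mule0.
  by rewrite -!EFinD -EFinM -mulrBr mulVKf// gt_eqF.
rewrite ge0_integral_mscale//; congr (_ * _)%E.
by rewrite ge0_integral_pushforward.
Qed.

(** Convolution with zero noise: the second law is a Dirac measure without density, so a change of
    variables replaces the product of densities. *)
Lemma normal_prob_scale (a m s : R) A : 0 < a -> 0 < s -> measurable A ->
  (\int[normal_prob m s]_y \d_(a * y)%R A)%E = normal_prob (a * m) (a * s) A.
Proof.
move=> a0 s0 mA.
have md : measurable_fun setT (fun x : mR => \d_x A : \bar R).
  exact: measurable_fun_dirac.
rewrite ge0_integral_normal_prob//; last first.
  by apply: (measurableT_comp md); exact: measurable_funM.
rewrite /normal_prob [RHS]integral_mkcond [RHS](@ge0_integral_lebesgue_scale a)//; last 2 first.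
- by move=> z; apply: erestrict_ge0 => {}z _; rewrite lee_fin normal_pdf_ge0.
- apply/(measurable_restrictT _ mA)/measurable_funTS.
  by apply/measurable_EFinP; exact: measurable_normal_pdf.
rewrite -ge0_integralZl_EFin ?ltW//; last 2 first.
- by move=> z _; apply: erestrict_ge0 => {}z _; rewrite lee_fin normal_pdf_ge0.
- have h : measurable_fun setT ((fun x : mR => (normal_pdf (a * m) (a * s) x)%:E) \_ A).
    apply/(measurable_restrictT _ mA)/measurable_funTS.
    by apply/measurable_EFinP; exact: measurable_normal_pdf.
  by apply: (measurableT_comp h); exact: measurable_funM.
apply: eq_integral => y _; rewrite patchE diracE; case: ifP => _; last first.
  by rewrite mul0e mule0.
rewrite mul1e -EFinM; congr (_%:E).
rewrite !normal_pdfE ?gt_eqF ?mulr_gt0// mulrA; congr (_ * _).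
  rewrite /normal_peak.
  have -> : (a * s) ^+ 2 * pi *+ 2 = a ^+ 2 * (s ^+ 2 * pi *+ 2) by ring.
  rewrite [in RHS](sqrtrM _ (sqr_ge0 a)) sqrtr_sqr.
  by rewrite gtr0_norm// invfM mulrA divff ?gt_eqF// mul1r.
rewrite /normal_fun; congr expR; field.
by rewrite !gt_eqF.
Qed.

(* If Y has law N(m, v) and Z is N(0, w), independent of Y, then a Y + Z has law
   N(a m, a^2 v + w). *)
Lemma gauss_convolution (m v a w : R) A :
  0 <= v -> 0 <= a -> 0 <= w -> measurable A ->
  (\int[gauss m v]_y gauss (a * y) w A = gauss (a * m) (a ^+ 2 * v + w) A)%E.
Proof.
rewrite le_eqVlt => /predU1P[<-|v0] a0 w0 mA.
  rewrite mulr0 add0r integral_gauss0//.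
  by apply: measurable_fun_gauss => //; exact: measurable_funM.
move: w0; rewrite le_eqVlt => /predU1P[<-|w0].
  move: a0; rewrite le_eqVlt => /predU1P[<-|a0].
    rewrite expr0n/= !mul0r addr0.
    under eq_integral do rewrite mul0r.
    by rewrite integral_cst// [X in (_ * X)%E]probability_setT mule1.
  transitivity (\int[normal_prob m (Num.sqrt v)]_y \d_(a * y)%R A)%E.
    rewrite integral_gauss_normal//.
    by apply: eq_integral => y _; exact: gauss0.
  have e : a * Num.sqrt v = Num.sqrt (a ^+ 2 * v + 0).
    by rewrite addr0 sqrtrM ?sqr_ge0// sqrtr_sqr gtr0_norm.
  rewrite normal_prob_scale; [|exact: a0|by rewrite sqrtr_gt0|exact: mA].
  rewrite e; apply: esym; apply: gauss_neq0.
  by rewrite addr0 gt_eqF// mulr_gt0// exprn_gt0.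
have avw : 0 < a ^+ 2 * v + w by rewrite ltr_wpDl// mulr_ge0// ?sqr_ge0// ltW.
transitivity (\int[normal_prob m (Num.sqrt v)]_y
    normal_prob (a * y) (Num.sqrt w) A)%E.
  rewrite integral_gauss_normal//.
  by apply: eq_integral => y _; apply: gauss_neq0; rewrite gt_eqF.
rewrite normal_prob_convolution; [|by rewrite sqrtr_gt0..|exact: mA].
have -> : a ^+ 2 * Num.sqrt v ^+ 2 + Num.sqrt w ^+ 2 = a ^+ 2 * v + w.
  by rewrite !sqr_sqrtr// ltW.
by apply: esym; apply: gauss_neq0; rewrite gt_eqF.
Qed.

End gauss.

Section product_probability.
Context d1 d2 (T1 : measurableType d1) (T2 : measurableType d2) (R : realType).
Variables (P1 : probability T1 R) (P2 : probability T2 R).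

Definition product_probability : set (T1 * T2) -> \bar R := (P1 \x P2)%E.

HB.instance Definition _ := Measure.on product_probability.

Let product_probability_setT : product_probability setT = 1%E.
Proof.
rewrite /product_probability -setXTT [LHS]product_measure1E//.
by rewrite [X in (X * _)%E]probability_setT [X in (_ * X)%E]probability_setT mule1.
Qed.

HB.instance Definition _ := Measure_isProbability.Build _ _ _
  product_probability product_probability_setT.

End product_probability.

Section kcst.
Context d1 d2 (X : measurableType d1) (Y : measurableType d2) (R : realType).

Definition kcst (P : probability Y R) : X -> {measure set Y -> \bar R} := fun=> P.

Variable P : probability Y R.

Let measurable_kcst U : measurable U -> measurable_fun setT (kcst P ^~ U).
Proof. by move=> _; exact: measurable_cst. Qed.

HB.instance Definition _ := isKernel.Build _ _ X Y R (kcst P) measurable_kcst.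

Let kcst_prob x : kcst P x setT = 1%E.
Proof. exact: probability_setT. Qed.

HB.instance Definition _ := Kernel_isProbability.Build _ _ X Y R (kcst P) kcst_prob.

End kcst.

Section gauss_kernel.
Variable R : realType.
Local Notation mR := (measurableTypeR R).

Definition kgauss (q : mR * mR) : {measure set mR -> \bar R} := gauss q.1 q.2.

Let measurable_kgauss U : measurable U -> measurable_fun setT (kgauss ^~ U).
Proof. exact: measurable_gauss. Qed.

HB.instance Definition _ := isKernel.Build _ _ (mR * mR)%type mR R kgauss
  measurable_kgauss.

Let kgauss_prob q : kgauss q setT = 1%E.
Proof. exact: probability_setT. Qed.

HB.instance Definition _ := Kernel_isProbability.Build _ _ (mR * mR)%type mR R
  kgauss kgauss_prob.

Lemma measurable_mix_param (s t : R) : measurable_fun setT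
  (fun q : mR * mR => (s * Num.sqrt q.2 * q.1, t * (1 - q.2))).
Proof.
apply: measurable_fun_pair.
  apply: measurable_funM => //; apply: measurable_funM => //.
  exact: (measurableT_comp (continuous_measurable_fun (@sqrt_continuous R)) measurable_snd).
by apply: measurable_funM => //; exact: measurable_funB.
Qed.

Definition mix (H : probability mR R) (s t : R) : R.-pker mR ~> mR :=
  mkcomp (kcst H) (kprecomp kgauss (measurable_mix_param s t)).

Lemma mixE H s t x A :
  mix H s t x A = (\int[H]_r gauss (s * Num.sqrt r * x) (t * (1 - r)) A)%E.
Proof. by []. Qed.

Lemma ge0_integral_mix H s t x (f : mR -> \bar R) :
  (forall y, 0 <= f y)%E -> measurable_fun setT f ->
  (\int[mix H s t x]_y f y =
   \int[H]_r \int[gauss (s * Num.sqrt r * x) (t * (1 - r))]_y f y)%E.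
Proof. by move=> f0 mf; exact: integral_kcomp. Qed.

Lemma measurable_fun_mix_gauss (s t : R) (x : mR) A : measurable A ->
  measurable_fun setT (fun r : mR => gauss (s * Num.sqrt r * x) (t * (1 - r)) A).
Proof.
move=> mA; exact: (measurableT_comp (measurable_gauss mA)
  (measurableT_comp (measurable_mix_param s t) (pair1_measurable x))).
Qed.

Lemma measurable_fun_integral_gauss d (T : measurableType d) (f g : T -> mR)
    (h : (T * mR)%type -> \bar R) :
  measurable_fun setT f -> measurable_fun setT g ->
  (forall z, 0 <= h z)%E -> measurable_fun setT h ->
  measurable_fun setT (fun x => \int[gauss (f x) (g x)]_y h (x, y))%E.
Proof.
move=> mf mg h0 mh; have mfg : measurable_fun setT (fun x => (f x, g x)).
  exact: measurable_fun_pair.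
exact: (measurable_fun_integral_finite_kernel h (kprecomp kgauss mfg)).
Qed.

End gauss_kernel.

Lemma ge0_integral_conull d (T : measurableType d) (R : realType)
    (P : probability T R) (D : set T) (f : T -> \bar R) :
  measurable D -> P D = 1%E -> (forall x, 0 <= f x)%E -> measurable_fun setT f ->
  (\int[P]_x f x = \int[P]_(x in D) f x)%E.
Proof.
move=> mD PD f0 mf; have mC : measurable (~` D) by exact: measurableC.
have PC : P (~` D) = 0%E by rewrite probability_setC// PD subee.
by rewrite (ge0_negligible_integral mC measurableT mf)// setTD setCK.
Qed.

(** * The semi-group and the Gaussian mixture kernels *)

Section semigroup.
Local Open Scope ereal_scope.
Variable R : realType.
Local Notation mR := (measurableTypeR R).
Variable G : R -> probability mR R.
Hypothesis hG : log_convolution_semigroup G.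

(** [G s] is concentrated on [0, 1], so integrands may differ outside, where variances such as t (1
    - r) can be negative. *)
Lemma eq_integral_semigroup s (f g : mR -> \bar R) : (1 <= s)%R ->
  (forall r, 0 <= f r) -> (forall r, 0 <= g r) ->
  measurable_fun setT f -> measurable_fun setT g ->
  (forall r, (0 <= r <= 1)%R -> f r = g r) ->
  \int[G s]_r f r = \int[G s]_r g r.
Proof.
move=> s1 f0 g0 mf mg fg.
have mI : measurable (`[0%R, 1%R] : set mR) by exact: measurable_itv.
rewrite (ge0_integral_conull mI (hG.1 s s1) f0 mf).
rewrite (ge0_integral_conull mI (hG.1 s s1) g0 mg).
by apply: eq_integral => r; rewrite inE/= in_itv/=; exact: fg.
Qed.

(** The semi-group law speaks of arbitrary independent variables; it is applied to the two
    coordinates of the product of [G s] and [G t]. *)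
Lemma integral_semigroup_mul s t (f : mR -> \bar R) : (1 <= s)%R -> (1 <= t)%R ->
  (forall r, 0 <= f r) -> measurable_fun setT f ->
  \int[G s]_q \int[G t]_r f (q * r)%R = \int[G (s * t)]_r f r.
Proof.
move=> s1 t1 f0 mf.
pose P : probability (mR * mR)%type R := product_probability (G s) (G t).
have mfst : measurable_fun [set: (mR * mR)%type] (fun w : (mR * mR)%type => w.1 : R).
  exact: measurable_fst.
have msnd : measurable_fun [set: (mR * mR)%type] (fun w : (mR * mR)%type => w.2 : R).
  exact: measurable_snd.
pose X : {RV P >-> R} := @mfun_Sub _ _ (mR * mR)%type R _ (mem_set mfst).
pose Y : {RV P >-> R} := @mfun_Sub _ _ (mR * mR)%type R _ (mem_set msnd).
have mXY : measurable_fun setT (fun w : mR * mR => w.1 * w.2 : mR)%R.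
  exact: measurable_funM.
have PE (A B : set mR) : measurable A -> measurable B ->
    P (A `*` B) = G s A * G t B by exact: product_measure1E.
have PX A : measurable A -> P (X @^-1` A) = G s A.
  move=> mA; rewrite (_ : _ @^-1` _ = A `*` setT); last first.
    by apply/seteqP; split => x //= [].
  by rewrite PE// probability_setT mule1.
have PY A : measurable A -> P (Y @^-1` A) = G t A.
  move=> mA; rewrite (_ : _ @^-1` _ = setT `*` A); last first.
    by apply/seteqP; split => x //= [].
  by rewrite PE// probability_setT mul1e.
have PXY := hG.2 s t s1 t1 _ _ P X Y.
transitivity (\int[P]_w f (w.1 * w.2)%R).
  rewrite (@fubini_tonelli1 _ _ _ _ _ (G s) (G t) (fun w => f (w.1 * w.2)%R))//.
  exact: (measurableT_comp mf mXY).
transitivity (\int[pushforward P (fun w : mR * mR => w.1 * w.2 : mR)%R]_r f r).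
  by rewrite ge0_integral_pushforward.
apply: eq_measure_integral => A mA _; apply: PXY => //.
by move=> B C mB mC; rewrite PX// PY// -PE.
Qed.

End semigroup.

Section gaussian_kernels.
Local Open Scope ereal_scope.
Variable R : realType.
Local Notation mR := (measurableTypeR R).
Variable G : R -> probability mR R.
Hypothesis hG : log_convolution_semigroup G.

(** At [s = 0] the law N(0, t) replaces N(x, t) for every x: this makes the Chapman-Kolmogorov
    equation true from all starting points and changes nothing at x = 0. *)
Definition mixture_kernel (s t : R) : R.-pker mR ~> mR :=
  if s == 0%R then (kcst (gauss 0 t) : R.-pker mR ~> mR)
  else mix (G (Num.sqrt (t / s))) (Num.sqrt (t / s)) t.

Lemma sqrt_ratio_ge1 (s t : R) : (0 < s)%R -> (s <= t)%R -> (1 <= Num.sqrt (t / s))%R.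
Proof.
move=> s0 st; rewrite -[leLHS]sqrtr1 ler_wsqrtr//.
by rewrite ler_pdivlMr// mul1r.
Qed.

Lemma mixture_kernel_chapman_kolmogorov (s t u : R) x A : (0 <= s)%R -> (s < t)%R ->
  (t < u)%R -> measurable A ->
  \int[mixture_kernel s t x]_y mixture_kernel t u y A = mixture_kernel s u x A.
Proof.
move=> s0 st tu mA.
have t0 : (0 < t)%R by exact: le_lt_trans st.
have u0 : (0 < u)%R by exact: lt_trans tu.
rewrite /mixture_kernel (gt_eqF t0); set b := Num.sqrt (u / t).
have b1 : (1 <= b)%R by apply: sqrt_ratio_ge1 => //; exact: ltW.
have b2 : (b ^+ 2 = u / t)%R by rewrite sqr_sqrtr// divr_ge0// ltW.
(* Since b^2 t = u, the variance accumulated through r and r' depends on the product r r' only. *)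
have var (r' : R) : (0 <= r' <= 1)%R -> forall r, (0 <= r <= 1)%R ->
  ((b * Num.sqrt r') ^+ 2 * (t * (1 - r)) + u * (1 - r') = u * (1 - r * r'))%R.
  move=> /andP[r'0 _] r _; rewrite exprMn b2 sqr_sqrtr//.
  by field; rewrite gt_eqF.
pose h (z : mR * mR) := gauss (b * Num.sqrt z.1 * z.2) (u * (1 - z.1)) A.
have h0 z : 0 <= h z by [].
have msqrt : measurable_fun setT (Num.sqrt : mR -> mR).
  exact: (continuous_measurable_fun (@sqrt_continuous R)).
have mh : measurable_fun setT h.
  apply: measurable_fun_gauss => //.
    apply: measurable_funM => //; apply: measurable_funM => //.
    exact: measurableT_comp.
  by apply: measurable_funM => //; exact: measurable_funB.
have swap m v : \int[gauss m v]_y mix (G b) b u y A =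
    \int[G b]_r \int[gauss m v]_y h (r, y).
  by rewrite -(@fubini_tonelli _ _ _ _ _ (G b) (gauss m v) h).
have mGh (m v : R) : measurable_fun setT (fun r : mR => \int[gauss m v]_y h (r, y)).
  exact: (measurable_fun_integral_gauss (T := mR)).
have hE m v r : (0 <= v)%R -> (0 <= r <= 1)%R -> \int[gauss m v]_y h (r, y) =
    gauss (b * Num.sqrt r * m) ((b * Num.sqrt r) ^+ 2 * v + u * (1 - r)) A.
  move=> v0 /andP[r0 r1]; apply: (@gauss_convolution R m v (b * Num.sqrt r) (u * (1 - r)) A v0) => //.
    by rewrite mulr_ge0// (le_trans _ b1).
  by rewrite mulr_ge0 ?(ltW u0)// subr_ge0.
have [sE|sN0] := eqVneq s 0%R.
  rewrite [LHS]swap.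
  transitivity (\int[G b]_r cst (gauss 0 u A) r).
    apply: (eq_integral_semigroup hG b1).
    - by move=> r; exact: integral_ge0.
    - by move=> r; exact: measure_ge0.
    - exact: mGh.
    - exact: measurable_cst.
    move=> r r01.
    (* This is [var] with its second parameter 0: from N(0, t), every component of the mixture is
       already N(0, u). *)
    have e : ((b * Num.sqrt r) ^+ 2 * t + u * (1 - r) = u)%R.
      by have := var _ r01 0%R; rewrite lexx ler01 subr0 mulr1 mul0r subr0 mulr1; exact.
    rewrite [LHS](hE _ _ _ (ltW t0) r01).
    rewrite e.
    by rewrite mulr0.
  by rewrite integral_cst// [X in (_ * X)]probability_setT mule1.
have {}s0 : (0 < s)%R by rewrite lt_neqAle eq_sym sN0.
set a := Num.sqrt (t / s).
have a1 : (1 <= a)%R by apply: sqrt_ratio_ge1 => //; exact: ltW.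
(* Time ratios multiply, which matches the index of the product in the semi-group law. *)
have abE : Num.sqrt (u / s) = (a * b)%R.
  rewrite -sqrtrM; last by rewrite divr_ge0// ltW.
  by congr Num.sqrt; field; rewrite !gt_eqF.
rewrite ge0_integral_mix//; last first.
  exact: (measurable_kernel (mix (G b) b u) A mA).
rewrite abE mixE.
have mg0 := measurable_fun_mix_gauss (a * b) u x mA.
rewrite -(integral_semigroup_mul hG a1 b1 _ mg0); last first.
  by move=> r; exact: measure_ge0.
pose g (z : mR * mR) := gauss (a * b * Num.sqrt (z.1 * z.2) * x) (u * (1 - z.1 * z.2)) A.
have g0 z : 0 <= g z by exact: measure_ge0.
have mg : measurable_fun setT g.
  have mm : measurable_fun setT (fun z : mR * mR => z.1 * z.2 : mR)%R.
    exact: measurable_funM.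
  exact: (measurableT_comp mg0 mm).
apply: (eq_integral_semigroup hG a1).
- by move=> r; exact: integral_ge0.
- by move=> r; exact: integral_ge0.
- apply: (measurable_fun_integral_gauss (T := mR) (h := fun z => mix (G b) b u z.2 A)) => //.
  + by apply: measurable_funM => //; exact: measurable_funM.
  + by apply: measurable_funM => //; exact: measurable_funB.
  + exact: (measurableT_comp (measurable_kernel (mix (G b) b u) A mA) measurable_snd).
- exact: (@measurable_fun_fubini_tonelli_F _ _ _ _ _ (G b) g mg g0).
- move=> r r01; rewrite swap; apply: (eq_integral_semigroup hG b1).
  + by move=> r'; exact: integral_ge0.
  + by move=> r'; exact: measure_ge0.
  + exact: mGh.
  + exact: (measurableT_comp mg (pair1_measurable r)).
  move=> r' r'01.
  have v0 : (0 <= t * (1 - r))%R.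
    by case/andP: r01 => r0 r1; rewrite mulr_ge0 ?(ltW t0)// subr_ge0.
  rewrite [LHS](hE _ _ _ v0 r'01).
  rewrite (var _ r'01 _ r01).
  have -> // : (b * Num.sqrt r' * (a * Num.sqrt r * x) =
    a * b * Num.sqrt (r * r') * x)%R.
  by case/andP: r01 => r0 r1; rewrite sqrtrM//; ring.
Qed.

(** At r = 1 the variance vanishes, which gives the atom at sigma x; for r < 1 the component has a
    density, and Tonelli moves the integral over r inside. *)
Lemma mixture_kernel_transition (s t : R) x A : (0 < s)%R -> (s < t)%R -> measurable A ->
  mixture_kernel s t x A = transition G s t x A.
Proof.
move=> s0 st mA; rewrite /mixture_kernel /transition gt_eqF//.
set a := Num.sqrt _.
have t0 : (0 < t)%R by exact: lt_trans st.
have a1 : (1 <= a)%R by apply: sqrt_ratio_ge1 => //; exact: ltW.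
rewrite mixE; set f := (fun r => _).
have f0 r : 0 <= f r by [].
have mf : measurable_fun setT f by exact: measurable_fun_mix_gauss.
transitivity (\int[G a]_(r in `[0%R, 1%R]) f r).
  by apply: (ge0_integral_conull _ (hG.1 _ a1)) => //; exact: measurable_itv.
have I01 : `[0%R, 1%R]%classic = [set 1%R] `|` `[0%R, 1%R[%classic :> set R.
  by rewrite setUC setUitv1// bnd_simp.
rewrite I01 ge0_integral_setU//; last 2 first.
- exact: measurable_funTS.
- rewrite disj_set2E; apply/eqP/seteqP; split => // r [/= ->].
  by rewrite in_itv/= ltxx andbF.
congr (_ + _).
  rewrite (eq_integral (cst (f 1%R))); last by move=> r; rewrite inE/= => ->.
  rewrite integral_cst// muleC /f sqrtr1 mulr1 subrr mulr0.
  by rewrite gauss0.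
pose I : set mR := `[0%R, 1%R[%classic.
pose k (z : mR * mR) := gauss_density (a * Num.sqrt z.1 * x) (t * (1 - z.1)) z.2.
pose d (z : mR * mR) : \bar R := (\1_I z.1 * (\1_A z.2 * k z))%:E.
have k0 z : (0 <= k z)%R by exact: normal_pdf_ge0.
have d0 z : 0 <= d z by rewrite lee_fin !mulr_ge0.
have msqrt : measurable_fun setT (Num.sqrt : mR -> mR).
  exact: (continuous_measurable_fun (@sqrt_continuous R)).
have mk : measurable_fun setT k.
  apply: measurable_fun_normal_pdf => //.
    by apply: measurable_funM => //; apply: measurable_funM => //; exact: measurableT_comp.
  apply: measurableT_comp => //.
  by apply: measurable_funM => //; exact: measurable_funB.
have m1 (B : set mR) : measurable B -> measurable_fun setT (\1_B : mR -> R).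
  by move=> mB; exact: measurable_indic.
have md : measurable_fun setT d.
  apply/measurable_EFinP; apply: measurable_funM.
    have mI : measurable I by exact: measurable_itv.
    exact: (measurableT_comp (m1 I mI) measurable_fst).
  apply: measurable_funM => //.
  exact: (measurableT_comp (m1 A mA) measurable_snd).
transitivity (\int[G a]_r \int[lebesgue_measure]_y d (r, y)).
  rewrite integral_mkcond; apply: eq_integral => r _.
  rewrite patchE /d /= indicE; case: ifPn => [|_]; last first.
    by rewrite integral0_eq// => y _; rewrite mul0r.
  rewrite inE/= in_itv/= => /andP[r0 r1].
  rewrite /f gauss_neq0; last by rewrite gt_eqF// mulr_gt0// subr_gt0.
  rewrite /normal_prob integral_mkcond; apply: eq_integral => y _.
  by rewrite patchE indicE mul1r; case: ifP; rewrite ?mul1r ?mul0r.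
rewrite (@fubini_tonelli _ _ _ _ _ (G a) lebesgue_measure d)//.
rewrite [RHS]integral_mkcond; apply: eq_integral => y _.
rewrite patchE /d /=; case: ifPn => yA; last first.
  by rewrite integral0_eq// => r _; rewrite [\1_A _]indicE (negbTE yA) mul0r mulr0.
rewrite [RHS]integral_mkcond; apply: eq_integral => r _.
by rewrite patchE !indicE yA mul1r; case: ifP; rewrite ?mul1r ?mul0r.
Qed.

End gaussian_kernels.

(** * The martingale property *)

Section normal_mean.
Local Open Scope ereal_scope.
Variable R : realType.
Local Notation mR := (measurableTypeR R).
Local Notation leb := (@lebesgue_measure R).

Lemma ge0_integral_lebesgue_reflect (c : R) (g : mR -> \bar R) :
  (forall x, 0 <= g x) -> measurable_fun setT g ->
  \int[leb]_x g x = \int[leb]_x g (c - x)%R.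
Proof.
move=> g0 mg; pose phi (x : mR) : mR := (c - x)%R.
have mphi : measurable_fun setT phi by exact: measurable_funB.
pose m : {measure set mR -> \bar R} := pushforward leb phi.
transitivity (\int[m mphi]_x g x)%E.
  apply: eq_measure_integral => A mA _; apply/lebesgue_measure_unique => //.
  move=> _ [[a b] _ <-] /=.
  change (leb `]a, b]%classic = leb (phi @^-1` `]a, b]%classic))%E.
  (* The reflection turns a left-open interval into a right-open one of the same length. *)
  have -> : phi @^-1` `]a, b]%classic = `[(c - b)%R, (c - a)%R[%classic.
    by apply/seteqP; split => x /=; rewrite !in_itv/= /phi ltrBrDl -ltrBrDr lerBlDl -lerBlDr andbC.
  rewrite !lebesgue_measure_itv/= !lte_fin ltrD2l ltrN2.
  case: ifP => // _; rewrite -!EFinD; congr (_%:E); ring.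
by rewrite ge0_integral_pushforward.
Qed.

(** Symmetry about [m], from which [integral_gauss] obtains the mean without an antiderivative. *)
Lemma normal_prob_reflect (m s : R) A : (0 < s)%R -> measurable A ->
  normal_prob m s ((fun y => 2 * m - y)%R @^-1` A) = normal_prob m s A.
Proof.
move=> s0 mA; rewrite /normal_prob [LHS]integral_mkcond [RHS]integral_mkcond.
rewrite [RHS](@ge0_integral_lebesgue_reflect (2 * m)); last 2 first.
- by move=> x; apply: erestrict_ge0 => {}x _; rewrite lee_fin normal_pdf_ge0.
- apply/(measurable_restrictT _ mA)/measurable_funTS.
  by apply/measurable_EFinP; exact: measurable_normal_pdf.
apply: eq_integral => y _; rewrite !patchE.
have -> : (y \in (fun y => 2 * m - y)%R @^-1` A) = (2 * m - y \in A)%R.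
  by apply/idP/idP; rewrite !inE.
have nE : normal_fun m s (2 * m - y) = normal_fun m s y.
  by rewrite /normal_fun (_ : 2 * m - y - m = - (y - m))%R ?sqrrN//; ring.
by rewrite !normal_pdfE ?gt_eqF// nE.
Qed.

(** With u = |y - m| / s and e = exp(- u^2 / 4), the deviation sqrt(2) s is chosen so that its
    exponential is e while the original one is e^2. It remains that u e is at most 1, by u <= 1 +
    u^2 / 4 <= exp(u^2 / 4). *)
Lemma normal_pdf_abs_le (m s y : R) : (0 < s)%R ->
  (`|y - m| * normal_pdf m s y <=
   Num.sqrt 2 * s * normal_pdf m (Num.sqrt 2 * s) y)%R.
Proof.
move=> s0; have r0 : (0 < Num.sqrt 2 :> R)%R by rewrite sqrtr_gt0.
rewrite !normal_pdfE ?gt_eqF ?mulr_gt0//.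
have -> : (normal_peak (Num.sqrt 2 * s) = (Num.sqrt 2)^-1 * normal_peak s)%R.
  rewrite /normal_peak.
  have -> : ((Num.sqrt 2 * s) ^+ 2 * pi *+ 2 = Num.sqrt 2 ^+ 2 * (s ^+ 2 * pi *+ 2) :> R)%R by ring.
  by rewrite (sqrtrM _ (sqr_ge0 _)) sqrtr_sqr gtr0_norm// invfM.
rewrite mulrCA [leRHS](_ : _ = normal_peak s * (s * normal_fun m (Num.sqrt 2 * s) y))%R; last first.
  by field; rewrite gt_eqF.
rewrite ler_wpM2l ?normal_peak_ge0//.
set u := (`|y - m| / s)%R.
have u2 : (u ^+ 2 = (y - m) ^+ 2 / s ^+ 2)%R.
  by rewrite /u expr_div_n real_normK ?num_real.
pose e := expR (- (u ^+ 2 / 4)).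
have -> : normal_fun m s y = (e * e)%R.
  by rewrite -expRD /normal_fun; congr expR; rewrite u2; field; rewrite gt_eqF.
have -> : normal_fun m (Num.sqrt 2 * s) y = e.
  rewrite /normal_fun; congr expR; rewrite u2 exprMn sqr_sqrtr//.
  by field; rewrite gt_eqF.
have -> : `|y - m|%R = (s * u)%R by rewrite mulrCA divff ?mulr1// gt_eqF.
rewrite -mulrA ler_pM2l// mulrA ler_piMl ?expR_ge0//.
rewrite /e expRN ler_pdivrMr ?expR_gt0// mul1r.
apply: le_trans (expR_ge1Dx _).
have := sqr_ge0 (u / 2 - 1)%R; lra.
Qed.

End normal_mean.

Section gauss_mean.
Local Open Scope ereal_scope.
Variable R : realType.
Local Notation mR := (measurableTypeR R).

Lemma ge0_integral_normal_abs (m s : R) : (0 < s)%R ->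
  \int[normal_prob m s]_y `|y|%:E <= (`|m| + Num.sqrt 2 * s)%:E.
Proof.
move=> s0; have mabs (c : R) : measurable_fun setT (fun y : mR => `|y - c|%:E).
  apply/measurable_EFinP; apply: measurableT_comp => //.
  exact: measurable_funB.
apply: (@le_trans _ _ (\int[normal_prob m s]_y (`|m|%:E + `|y - m|%:E))).
  apply: ge0_le_integral => //.
  - by apply/measurable_EFinP; exact: normr_measurable.
  - apply: emeasurable_funD; [exact: measurable_cst|exact: (mabs m)].
  - by move=> y _; rewrite -EFinD lee_fin (le_trans _ (ler_normD _ _))// addrC subrK.
rewrite ge0_integralD//.
rewrite integral_cst// [X in _ * X + _]probability_setT mule1 EFinD leeD2l//.
rewrite ge0_integral_normal_prob//; last exact: (mabs m).
apply: (@le_trans _ _ (\int[lebesgue_measure]_y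
    ((Num.sqrt 2 * s)%:E * (normal_pdf m (Num.sqrt 2 * s) y)%:E))).
  apply: ge0_le_integral => //.
  - by move=> y _; rewrite -EFinM lee_fin mulr_ge0// normal_pdf_ge0.
  - apply: emeasurable_funM; first exact: (mabs m).
    by apply/measurable_EFinP; exact: measurable_normal_pdf.
  - apply: emeasurable_funM => //.
    by apply/measurable_EFinP; exact: measurable_normal_pdf.
  - by move=> y _; rewrite -!EFinM lee_fin normal_pdf_abs_le.
rewrite ge0_integralZl_EFin//.
- by rewrite integral_normal_pdf mule1.
- by move=> y _; rewrite lee_fin normal_pdf_ge0.
- by apply/measurable_EFinP; exact: measurable_normal_pdf.
- by rewrite mulr_ge0// ltW.
Qed.

Lemma ge0_integral_gauss_abs (m v : R) : (0 <= v)%R ->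
  \int[gauss m v]_y `|y|%:E <= (`|m| + Num.sqrt 2 * Num.sqrt v)%:E.
Proof.
rewrite le_eqVlt => /predU1P[<-|v0].
  rewrite integral_gauss0; first by rewrite sqrtr0 mulr0 addr0.
  by apply/measurable_EFinP; exact: normr_measurable.
by rewrite integral_gauss_normal// ge0_integral_normal_abs// sqrtr_gt0.
Qed.

Lemma integrable_gauss (m v : R) : (0 <= v)%R ->
  (gauss m v).-integrable setT (EFin : mR -> \bar R).
Proof.
move=> v0; apply/integrableP; split; first exact/measurable_EFinP.
apply: (@le_lt_trans _ _ (\int[gauss m v]_y `|y|%:E)) => //.
by apply: (le_lt_trans (ge0_integral_gauss_abs m v0)); exact: ltry.
Qed.

(** By reflection the mean E satisfies E = 2 m - E; the absolute moment bound makes E finite, so the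
    equation can be solved. *)
Lemma integral_gauss (m v : R) : (0 <= v)%R ->
  \int[gauss m v]_y y%:E = m%:E.
Proof.
rewrite le_eqVlt => /predU1P[<-|v0].
  by rewrite integral_gauss0.
have sv0 : (0 < Num.sqrt v)%R by rewrite sqrtr_gt0.
have iN : (normal_prob m (Num.sqrt v)).-integrable setT (EFin : mR -> \bar R).
  apply/integrableP; split; first exact/measurable_EFinP.
  apply: (@le_lt_trans _ _ (\int[normal_prob m (Num.sqrt v)]_y `|y|%:E)) => //.
  by apply: (le_lt_trans (ge0_integral_normal_abs m sv0)); exact: ltry.
rewrite integral_gauss_normal//; set N := normal_prob m _ in iN *.
pose phi (y : mR) : mR := (2 * m - y)%R.
have mphi : measurable_fun setT phi by exact: measurable_funB.
have ic : N.-integrable setT (cst (2 * m)%:E : mR -> \bar R).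
  exact: finite_measure_integrable_cst.
have fN : \int[N]_y y%:E \is a fin_num by exact: integrable_fin_num.
have E : \int[N]_y y%:E = (2 * m)%:E - \int[N]_y y%:E.
  transitivity (\int[pushforward N phi]_y y%:E).
    by apply: eq_measure_integral => A mA _; apply: esym; exact: (normal_prob_reflect m sv0 mA).
  rewrite integral_pushforward//; last first.
    rewrite preimage_setT; apply: eq_integrable (integrableB measurableT ic iN) => //.
  rewrite preimage_setT.
  transitivity (\int[N]_y ((2 * m)%:E - y%:E)) => //.
  rewrite integralB// integral_cst//.
  by rewrite [X in _ * X]probability_setT mule1.
move: E fN; case: (\int[N]_y y%:E) => // r E _; congr (_%:E).
move: E; rewrite -EFinB => -[]; lra.
Qed.

End gauss_mean.

Section kfinite.
Context d1 d2 (X : measurableType d1) (Y : measurableType d2) (R : realType).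

Definition kfinite (m : {finite_measure set Y -> \bar R}) : X -> {measure set Y -> \bar R} :=
  fun=> m.

Variable m : {finite_measure set Y -> \bar R}.

Let measurable_kfinite U : measurable U -> measurable_fun setT (kfinite m ^~ U).
Proof. by move=> _; exact: measurable_cst. Qed.

HB.instance Definition _ := isKernel.Build _ _ X Y R (kfinite m) measurable_kfinite.

Let kfinite_uub : measure_fam_uub (kfinite m).
Proof.
exists (fine (m setT) + 1)%R => x; rewrite /kfinite.
by rewrite -[ltLHS]fineK ?fin_num_measure// lte_fin ltrDl.
Qed.

HB.instance Definition _ := Kernel_isFinite.Build _ _ X Y R (kfinite m) kfinite_uub.

End kfinite.

Lemma ge0_integral_mrestr d (T : measurableType d) (R : realType)
    (mu : {measure set T -> \bar R}) (C : set T) (mC : measurable C)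
    (g : T -> \bar R) : (forall x, 0 <= g x)%E -> measurable_fun setT g ->
  (\int[mrestr mu mC]_x g x = \int[mu]_(x in C) g x)%E.
Proof.
move=> g0 mg; pose f x : \bar R := (\1_C x)%:E.
have f0 x : (0 <= f x)%E by rewrite lee_fin.
have mf : measurable_fun setT f by apply/measurable_EFinP; exact: measurable_indic.
transitivity (\int[density_measure mu f0 mf]_x g x)%E.
  apply: eq_measure_integral => A mA _.
  by rewrite /= /density_measure integral_indic// setIC.
rewrite ge0_integral_density// [RHS]integral_mkcond; apply: eq_integral => x _.
by rewrite patchE /f indicE; case: ifP => _; rewrite ?mule1 ?mule0.
Qed.

Section markov_martingale.
Local Open Scope ereal_scope.
Context d (Omega : measurableType d) (R : realType) (P : probability Omega R).
Variables (X : R -> {RV P >-> R})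
  (p : R -> R -> R.-pker (measurableTypeR R) ~> (measurableTypeR R)).
Hypothesis markov : forall (s t : R) A, (0 <= s)%R -> (s < t)%R -> measurable A ->
  is_cond_expectation P (natural_filtration X s)
    (fun w => (\1_(X t @^-1` A) w)%:E) (fun w => p s t (X s w) A).

Lemma measurable_natural_filtration s C : natural_filtration X s C -> measurable C.
Proof.
apply: smallest_sub; first exact: sigma_algebra_measurable.
by move=> _ [u [B [_ mB ->]]]; exact: measurable_funPTI.
Qed.

(** Both sides integrate [f] against a measure: [P] restricted to [C] followed by the kernel, and
    the image under [X t] of that restriction. The Markov hypothesis says that the two agree on
    sets. *)
Lemma ge0_integral_markov (s t : R) (C : set Omega) (f : R -> \bar R) :
  (0 <= s)%R -> (s < t)%R -> natural_filtration X s C ->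
  (forall y, 0 <= f y) -> measurable_fun setT f ->
  \int[P]_(w in C) \int[p s t (X s w)]_y f y = \int[P]_(w in C) f (X t w).
Proof.
move=> s0 st FC f0 mf; have mC := measurable_natural_filtration FC.
have Coo : P C < +oo by rewrite (le_lt_trans (probability_le1 P mC))// ltry.
pose m : {finite_measure set Omega -> \bar R} := mfrestr mC Coo.
have mX (u : R) : measurable_fun setT (X u : Omega -> measurableTypeR R).
  exact: (measurable_funPT (X u)).
(* A kernel from a one-point space is a measure; this puts the initial measure into the form that
   kernel composition expects. *)
pose l : R.-fker unit ~> Omega := kfinite m.
have mXs : measurable_fun setT (fun z : (unit * Omega)%type => X s z.2 : measurableTypeR R).
  exact: (measurableT_comp (mX s) measurable_snd).
pose k : R.-pker (unit * Omega)%type ~> (measurableTypeR R) := kprecomp (p s t) mXs.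
have mg : measurable_fun setT (fun w => \int[p s t (X s w)]_y f y).
  apply: (measurable_fun_integral_kernel (l := fun w => p s t (X s w))) => //.
  by move=> U mU; exact: (measurableT_comp (measurable_kernel (p s t) U mU) (mX s)).
rewrite -(ge0_integral_mrestr P mC)//; last by move=> w; exact: integral_ge0.
rewrite -(ge0_integral_mrestr P mC (g := f \o X t)); last 2 first.
- by move=> w; exact: f0.
- exact: measurableT_comp.
transitivity (\int[kcomp l k tt]_y f y).
  by rewrite integral_kcomp.
pose m2 : {measure set (measurableTypeR R) -> \bar R} :=
  pushforward m (X t : Omega -> measurableTypeR R).
transitivity (\int[m2 (mX t)]_y f y); last first.
  by rewrite ge0_integral_pushforward.
apply: eq_measure_integral => A mA _.
have [_ _ E] := markov s0 st mA.
rewrite /kcomp.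
transitivity (\int[P]_(w in C) p s t (X s w) A).
  apply: (ge0_integral_mrestr P mC (g := fun w => p s t (X s w) A)) => //.
  exact: (measurableT_comp (measurable_kernel (p s t) A mA) (mX s)).
rewrite E// integral_indic//; exact: measurable_funPTI.
Qed.

Hypothesis integrable_X : forall t, (0 <= t)%R -> P.-integrable setT (EFin \o X t).
(** Demanded only along the values of the process: a kernel such as N(0, t) preserves the mean at 0
    alone. *)
Hypothesis mean_p : forall s t w, (0 <= s)%R -> (s < t)%R ->
  \int[p s t (X s w)]_y y%:E = (X s w)%:E.

(** The Markov identity is available for nonnegative functions, so it is applied to the positive and
    negative parts of the identity, whose integrals are finite and can be subtracted. *)
Lemma markov_martingale : martingale X.
Proof.
have mE : measurable_fun setT (EFin : R -> \bar R) by exact/measurable_EFinP.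
split=> // s t s0; rewrite le_eqVlt => /predU1P[<-|st].
  split => //; last exact: integrable_X.
  move=> B mB; apply: sub_sigma_algebra; exists s, (EFin @^-1` B).
  split; [by rewrite s0 lexx| |by []].
  by rewrite -[X in measurable X]setTI; exact: mE.
split.
- move=> B mB; apply: sub_sigma_algebra; exists s, (EFin @^-1` B).
  split; [by rewrite s0 lexx| |by []].
  by rewrite -[X in measurable X]setTI; exact: mE.
- exact: integrable_X.
move=> C FC; have mC := measurable_natural_filtration FC.
have t0 : (0 <= t)%R by exact/ltW/(le_lt_trans s0).
have mEp : measurable_fun setT (EFin ^\+ : R -> \bar R) by exact: measurable_funepos.
have mEn : measurable_fun setT (EFin ^\- : R -> \bar R) by exact: measurable_funeneg.
pose ep w := \int[p s t (X s w)]_y (EFin ^\+ y).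
pose en w := \int[p s t (X s w)]_y (EFin ^\- y).
have iX : P.-integrable C (EFin \o X t).
  by apply: integrableS (integrable_X t0).
have epE : \int[P]_(w in C) ep w = \int[P]_(w in C) ((EFin \o X t)^\+ w).
  rewrite (ge0_integral_markov s0 st FC _ mEp); last by move=> y; exact: funepos_ge0.
  by apply: eq_integral => w _; rewrite !funeposE.
have enE : \int[P]_(w in C) en w = \int[P]_(w in C) ((EFin \o X t)^\- w).
  rewrite (ge0_integral_markov s0 st FC _ mEn); last by move=> y; exact: funeneg_ge0.
  by apply: eq_integral => w _; rewrite !funenegE.
have mX (u : R) : measurable_fun setT (X u : Omega -> measurableTypeR R).
  exact: (measurable_funPT (X u)).
have mep : measurable_fun setT ep.
  apply: (measurable_fun_integral_kernel (l := fun w => p s t (X s w))) => //.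
    by move=> U mU; exact: (measurableT_comp (measurable_kernel (p s t) U mU) (mX s)).
have men : measurable_fun setT en.
  apply: (measurable_fun_integral_kernel (l := fun w => p s t (X s w))) => //.
    by move=> U mU; exact: (measurableT_comp (measurable_kernel (p s t) U mU) (mX s)).
have ep0 w : 0 <= ep w by exact: integral_ge0.
have en0 w : 0 <= en w by exact: integral_ge0.
have iep : P.-integrable C ep.
  apply/integrableP; split; first exact: measurable_funTS.
  under eq_integral do rewrite gee0_abs//.
  rewrite epE; have /integrableP[_] := integrable_funepos mC iX.
  by under eq_integral do rewrite gee0_abs//.
have ien : P.-integrable C en.
  apply/integrableP; split; first exact: measurable_funTS.
  under eq_integral do rewrite gee0_abs//.
  rewrite enE; have /integrableP[_] := integrable_funeneg mC iX.
  by under eq_integral do rewrite gee0_abs//.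
rewrite [RHS]integralE -epE -enE -integralB//.
apply: eq_integral => w _ /=; rewrite -(mean_p w s0 st).
by rewrite [LHS]integralE.
Qed.

End markov_martingale.

Section gaussian_mean.
Local Open Scope ereal_scope.
Variable R : realType.
Local Notation mR := (measurableTypeR R).
Variable G : R -> probability mR R.
Hypothesis hG : log_convolution_semigroup G.
Hypothesis G_sqrt : forall s : R, (1 <= s)%R ->
  \int[G s]_(r in `[0%R, 1%R]) (Num.sqrt r)%:E = (s^-1)%:E.

(** Given r, the mean is a sqrt(r) x, and [G_sqrt] averages it to x. The two signs are treated
    apart, as integration through [mix] is stated for nonnegative functions. *)
Lemma integral_mixture_kernel (s t : R) x : (0 < s)%R -> (s < t)%R ->
  \int[mixture_kernel G s t x]_y y%:E = x%:E.
Proof.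
move=> s0 st; rewrite /mixture_kernel gt_eqF//; set a := Num.sqrt _.
have t0 : (0 < t)%R by exact: lt_trans st.
have a1 : (1 <= a)%R by apply: sqrt_ratio_ge1 => //; exact: ltW.
have a0 : (0 < a)%R by exact: lt_le_trans a1.
have mE : measurable_fun setT (EFin : mR -> \bar R) by exact/measurable_EFinP.
have mEp : measurable_fun setT (EFin ^\+ : mR -> \bar R) by exact: measurable_funepos.
have mEn : measurable_fun setT (EFin ^\- : mR -> \bar R) by exact: measurable_funeneg.
have mA : measurable_fun setT (fun y : mR => `|y%:E|).
  by apply/measurable_EFinP; exact: normr_measurable.
pose g (r : mR) := gauss (a * Num.sqrt r * x) (t * (1 - r)).
pose ep r := \int[g r]_y (EFin ^\+ y).
pose en r := \int[g r]_y (EFin ^\- y).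
have ep0 r : 0 <= ep r by apply: integral_ge0 => y _; exact: funepos_ge0.
have en0 r : 0 <= en r by apply: integral_ge0 => y _; exact: funeneg_ge0.
have msqrt : measurable_fun setT (Num.sqrt : mR -> mR).
  exact: (continuous_measurable_fun (@sqrt_continuous R)).
have mm : measurable_fun setT (fun r : mR => a * Num.sqrt r * x : mR)%R.
  by apply: measurable_funM => //; exact: measurable_funM.
have mv : measurable_fun setT (fun r : mR => t * (1 - r) : mR)%R.
  by apply: measurable_funM => //; exact: measurable_funB.
have mep : measurable_fun setT ep.
  apply: (measurable_fun_integral_gauss (h := fun z => EFin ^\+ z.2) mm mv).
    by move=> z; exact: funepos_ge0.
  exact: (measurableT_comp mEp measurable_snd).
have men : measurable_fun setT en.
  apply: (measurable_fun_integral_gauss (h := fun z => EFin ^\- z.2) mm mv).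
    by move=> z; exact: funeneg_ge0.
  exact: (measurableT_comp mEn measurable_snd).
have mI : measurable (`[0%R, 1%R] : set mR) by exact: measurable_itv.
(* Bound of the first absolute moment, uniform in r, from sqrt(r) <= 1 and t (1 - r) <= t. *)
pose M := (a * `|x| + Num.sqrt 2 * Num.sqrt t)%R.
have bound r : (0 <= r <= 1)%R -> \int[g r]_y `|y%:E| <= M%:E.
  move=> /andP[r0 r1].
  have v0 : (0 <= t * (1 - r))%R by rewrite mulr_ge0 ?(ltW t0)// subr_ge0.
  apply: (le_trans (ge0_integral_gauss_abs _ v0)).
  rewrite lee_fin lerD//.
    rewrite !normrM (ger0_norm (ltW a0)) (ger0_norm (sqrtr_ge0 _)).
    rewrite ler_wpM2r// ler_piMr ?(ltW a0)//.
    by rewrite -sqrtr1 ler_wsqrtr.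
  rewrite ler_wpM2l ?sqrtr_ge0// ler_wsqrtr//.
  by rewrite ler_piMr ?(ltW t0)// lerBlDr lerDl.
have gE r : (0 <= r <= 1)%R -> \int[g r]_y y%:E = (a * Num.sqrt r * x)%:E.
  by move=> /andP[r0 r1]; apply: integral_gauss; rewrite mulr_ge0 ?(ltW t0)// subr_ge0.
have iep : (G a).-integrable `[0%R, 1%R] ep.
  apply: (@le_integrable _ _ _ _ _ mI _ (cst M%:E)).
  - exact: measurable_funTS.
  - move=> r /=; rewrite in_itv/= => r01.
    rewrite gee0_abs// (@le_trans _ _ M%:E)//; last by rewrite lee_fin ler_norm.
    apply: le_trans (bound _ r01); apply: ge0_le_integral => //.
    by move=> y _; rewrite funeposE/= -EFin_max lee_fin ge_max ler_norm normr_ge0.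
  - exact: finite_measure_integrable_cst.
have ien : (G a).-integrable `[0%R, 1%R] en.
  apply: (@le_integrable _ _ _ _ _ mI _ (cst M%:E)).
  - exact: measurable_funTS.
  - move=> r /=; rewrite in_itv/= => r01.
    rewrite gee0_abs// (@le_trans _ _ M%:E)//; last by rewrite lee_fin ler_norm.
    apply: le_trans (bound _ r01); apply: ge0_le_integral => //.
    by move=> y _; rewrite funenegE/= -EFin_max lee_fin ge_max -normrN ler_norm normr_ge0.
  - exact: finite_measure_integrable_cst.
rewrite integralE (ge0_integral_mix _ _ _ _ _ mEp); last by move=> y; exact: funepos_ge0.
rewrite (ge0_integral_mix _ _ _ _ _ mEn); last by move=> y; exact: funeneg_ge0.
rewrite -[X in X - _]/(\int[G a]_r ep r) -[X in _ - X]/(\int[G a]_r en r).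
rewrite (ge0_integral_conull mI (hG.1 a a1) ep0 mep).
rewrite (ge0_integral_conull mI (hG.1 a a1) en0 men).
rewrite -integralB//.
transitivity (\int[G a]_(r in `[0%R, 1%R]) ((a * x)%:E * (Num.sqrt r)%:E)).
  apply: eq_integral => r; rewrite inE/= in_itv/= => r01.
  have -> : ep r - en r = \int[g r]_y y%:E by rewrite [RHS]integralE.
  by rewrite gE// -EFinM mulrAC.
rewrite integralZl//.
  by rewrite G_sqrt// -EFinM mulrAC divff ?mul1r// gt_eqF.
apply: (@le_integrable _ _ _ _ _ mI _ (cst 1%:E)).
- by apply/measurable_EFinP; exact: measurable_funTS.
- move=> r /=; rewrite in_itv/= => /andP[r0 r1].
  by rewrite lee_fin !ger0_norm ?sqrtr_ge0// -[leRHS]sqrtr1 ler_wsqrtr.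
- exact: finite_measure_integrable_cst.
Qed.

End gaussian_mean.

(** * From the Laplace exponent to the process *)

Lemma integral_sqrt_semigroup (R : realType)
    (G : R -> probability (measurableTypeR R) R) (psi : R -> R) (s : R) :
  has_laplace_exponent G psi -> psi (1 / 2) = 1 -> 1 <= s -> G s `[0%R, 1%R]%classic = 1%E ->
  (\int[G s]_(r in `[0%R, 1%R]) (Num.sqrt r)%:E = (s^-1)%:E)%E.
Proof.
move=> hpsi h1 s1 G1.
have := hpsi s (1 / 2) s1; rewrite h1 divr_gt0// => /(_ isT).
rewrite powR_inv1 ?(le_trans ler01)// unlock => <-.
rewrite (ge0_integral_conull _ G1)//; last 2 first.
- by move=> r; rewrite lee_fin powR_ge0.
- by apply/measurable_EFinP; exact: measurable_powR.
apply: eq_integral => r; rewrite inE/= in_itv/= => /andP[r0 _].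
by rewrite div1r powR12_sqrt.
Qed.

Theorem theorem3 (R : realType)
    (G : R -> probability (measurableTypeR R) R)
    (beta : R) (nu : {measure set (measurableTypeR R) -> \bar R})
    (hG : log_convolution_semigroup G)
    (hbeta : 0 <= beta) (hnu : levy_measure nu)
    (hpsi : has_laplace_exponent G (levy_exponent beta nu))
    (h1 : levy_exponent beta nu (1 / 2) = 1) :
  exists (d : measure_display) (Omega : measurableType d)
    (P : probability Omega R) (X : R -> {RV P >-> R}),
    [/\ forall w : Omega, X 0 w = 0,
        markov_process X (transition G),
        martingale X &
        forall t : R, 0 <= t -> has_law (X t) (gauss_law 0 t)].
Proof.
have [d [T [P [X [X0 markovX]]]]] :=
  markov_process_exists 0 (mixture_kernel_chapman_kolmogorov hG).
have lawX (t : R) A : 0 <= t -> measurable A -> P (X t @^-1` A) = gauss 0 t A.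
  rewrite le_eqVlt => /predU1P[<-|t0] mA.
    rewrite gauss0 diracE; have [A0|A0] := boolP (0 \in A).
      rewrite (_ : _ @^-1` _ = setT) ?probability_setT//.
      by apply/seteqP; split => // w _ /=; rewrite X0 -inE.
    rewrite (_ : _ @^-1` _ = set0) ?measure0//.
    apply/seteqP; split => // w /=; rewrite X0.
    by move=> /mem_set; rewrite (negbTE A0).
  (* The law of X_t is the Markov property from time 0, tested on the whole space. *)
  have [_ _ E] := markovX 0 t A (lexx _) t0 mA; have {E} := E setT.
  rewrite integral_indic// ?setIT; last exact: measurable_funPTI.
  move=> <-; last first.
    by rewrite -[X in natural_filtration _ _ X]setC0; apply: sigma_algebraC; exact: sigma_algebra0.
  rewrite /mixture_kernel eqxx (eq_integral (cst (gauss 0 t A)))//.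
  by rewrite integral_cst// [X in (_ * X)%E]probability_setT mule1.
(* At s = 0 the two kernels agree only at 0, which is where X_0 sits. *)
have mixture_kernel_transitionX (s t : R) w A : 0 <= s -> s < t -> measurable A ->
    mixture_kernel G s t (X s w) A = transition G s t (X s w) A.
  rewrite le_eqVlt => /predU1P[<-|s0] st mA; last exact: mixture_kernel_transition.
  rewrite X0 /mixture_kernel /transition eqxx; apply: gauss_neq0.
  by rewrite gt_eqF.
exists d, T, P, X; split => //.
- split=> [s t|s t A] s0 st.
    move: s0; rewrite le_eqVlt => /predU1P[s0|s0].
      (* The kernel clause of [markov_process] ranges over all x, so at s = 0 it needs the kernel
         N(x, t) itself. *)
      have mt : measurable_fun setT (fun x : measurableTypeR R => (x, t)).
        exact: measurable_fun_pair.
      exists (kprecomp (@kgauss R) mt) => x A mA.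
      rewrite /transition -s0 eqxx; apply: gauss_neq0.
      by rewrite gt_eqF// s0.
    exists (mixture_kernel G s t) => x A mA; exact: mixture_kernel_transition.
  move=> mA.
  rewrite (_ : (fun w => transition G s t (X s w) A) = fun w => mixture_kernel G s t (X s w) A).
    exact: markovX.
  by apply/funext => w; rewrite mixture_kernel_transitionX.
- apply: (markov_martingale markovX).
    move=> t t0; apply/integrableP; split; first exact/measurable_EFinP.
    have mX : measurable_fun setT (X t : T -> measurableTypeR R).
      exact: (measurable_funPT (X t)).
    pose m : {measure set (measurableTypeR R) -> \bar R} :=
      pushforward P (X t : T -> measurableTypeR R).
    suff <- : (\int[gauss 0 t]_y `|y%:E| = \int[P]_w `|(X t w)%:E|)%E.
      by have /integrableP[] := integrable_gauss 0 t0.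
    transitivity (\int[m mX]_y `|y%:E|)%E.
      by apply: eq_measure_integral => A mA _; apply: esym; exact: lawX.
    rewrite ge0_integral_pushforward//.
    by apply/measurable_EFinP; exact: normr_measurable.
  move=> s t w; rewrite le_eqVlt => /predU1P[<-|s0] st; last first.
    by apply: integral_mixture_kernel => // u; move=> u1; apply: (integral_sqrt_semigroup hpsi h1 u1); exact: hG.1.
  by rewrite X0 /mixture_kernel eqxx; apply: integral_gauss; exact: ltW.
- by move=> t t0 A mA; rewrite gauss_lawE; exact: lawX.
Qed.
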